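(* Let $\Gamma<\mathrm{PSL}_2(\mathbb{R})$ be a finitely generated, (orientation-preserving) finite coarea Fuchsian group. If $\Gamma$ admits a Double Dirichlet domain or a DF domain $P$, then there is a hyperbolic polygon $Q\subset\mathbb{H}^2$ such that $\Gamma$ is an index $2$ subgroup of the discrete group $G<\mathrm{Isom}(\mathbb{H}^2)$ of reflections in $Q$.
   Context: $\mathbb{H}^2$ is the upper half-plane with hyperbolic distance $d$; $\mathrm{PSL}_2(\mathbb{R})$ acts by Möbius transformations. A Fuchsian group is a discrete subgroup $\Gamma<\mathrm{PSL}_2(\mathbb{R})$; finite coarea means $\mathbb{H}^2/\Gamma$ has finite hyperbolic area. A fundamental domain for $\Gamma$ is a closed convex polygon whose $\Gamma$-translates cover $\mathbb{H}^2$ and whose interior is disjoint from its translates by nontrivial elements of $\Gamma$. Dirichlet domain centered at $z_0\in\mathbb{H}^2$: the set $\{x\in\mathbb{H}^2 : d(x,z_0)\le d(x,\alpha(z_0))\ \forall\, 1\ne\alpha\in\Gamma\}$. Ford domain: suppose $\infty$ is a parabolic fixed point of $\Gamma$, with stabilizer $\Gamma_\infty<\Gamma$. For $\gamma=\pm\begin{pmatrix}a&b\\c&d\end{pmatrix}\in\Gamma\setminus\Gamma_\infty$, the isometric circle is $S_\gamma=\{z:|cz+d|=1\}$. A Ford domain is the intersection of the set of points of $\mathbb{H}^2$ lying on or outside all isometric circles $S_\gamma$, $\gamma\in\Gamma\setminus\Gamma_\infty$, with a fundamental domain for the action of $\Gamma_\infty$ that is a vertical strip $\{x_0\le \mathrm{Re}(z)\le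 x_0+t\}$ (where $z\mapsto z+t$, $t>0$, generates $\Gamma_\infty$). A DF domain for $\Gamma$ is a fundamental domain for $\Gamma$ which is both a Ford domain and a Dirichlet domain for some center $z_0\in\mathbb{H}^2$. A Double Dirichlet domain for $\Gamma$ is a fundamental domain for $\Gamma$ which is the Dirichlet domain centered at $z_0$ and also the Dirichlet domain centered at $z_1$, for some $z_0\neq z_1$ in $\mathbb{H}^2$. Polygons are convex, finite-sided and of finite area (ideal vertices, with angle $0$, are allowed). The discrete group of reflections in a polygon $Q$ (discrete reflection group with respect to $Q$) is the group generated by the reflections of $\mathbb{H}^2$ in the sides of $Q$, where this group is discrete and the translates $gQ$, $g\in G$, tessellate $\mathbb{H}^2$; the angles of $Q$ are then each $0$ or $\pi/k$ for an integer $k\ge2$. *)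

(* Defs.v *)
From HB Require Import structures.
From mathcomp Require Import all_boot all_order all_algebra.
From mathcomp Require Import all_classical all_reals all_analysis.
From mathcomp.real_closed Require Import complex.

Set Implicit Arguments.
Unset Strict Implicit.
Unset Printing Implicit Defensive.

Import Order.TTheory GRing.Theory Num.Theory.
Import numFieldNormedType.Exports.
Local Open Scope classical_set_scope.
Local Open Scope ring_scope.
Local Open Scope complex_scope.
Local Open Scope card_scope.

Definition UHP (R : realType) := {z : R[i] | 0 < complex.Im z}.

Section HyperbolicPlane.
Variable R : realType.
Local Notation H := (UHP R).

Definition hRe (z : H) : R := complex.Re (val z).
Definition hIm (z : H) : R := complex.Im (val z).

(* UHP carries the subspace topology of the Euclidean plane, which is also the
   topology of the hyperbolic distance. *)
Definition to_plane (z : H) : R * R := (hRe z, hIm z).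

HB.instance Definition _ := Topological.copy H (initial_topology to_plane).

Definition arcosh (u : R) : R := ln (u + Num.sqrt (u ^+ 2 - 1)).

Definition hdist (z w : H) : R :=
  arcosh (1 + ComplexField.Normc.normc (val z - val w) ^+ 2
              / (2 * hIm z * hIm w)).

Definition harea (A : set H) : \bar R :=
  (\int[(lebesgue_measure \x lebesgue_measure)%E]_(p in to_plane @` A)
     ((p.2 ^+ 2)^-1)%:E)%E.

(* Groups of transformations: subsets of the bijections of the plane that are
   closed under composition and inverses. *)
Definition transformation_group (G : set (H -> H)) : Prop :=
  [/\ G id,
      forall f g, G f -> G g -> G (f \o g) &
      forall f, G f -> exists2 g, G g & cancel f g /\ cancel g f].

Definition generated (S : set (H -> H)) : set (H -> H) :=
  smallest transformation_group S.

Definition finitely_generated (G : set (H -> H)) : Prop :=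
  exists2 S, finite_set S & G = generated S.

Definition left_cosets (K G : set (H -> H)) : set (set (H -> H)) :=
  [set [set g \o k | k in K] | g in G].

Definition index2_subgroup (K G : set (H -> H)) : Prop :=
  [/\ transformation_group K, transformation_group G, K `<=` G &
      left_cosets K G #= `I_2].

Definition isom : set (H -> H) :=
  [set f : H -> H | bijective f /\ forall z w, hdist (f z) (f w) = hdist z w].

Definition discrete_set (T : topologicalType) (A : set T) : Prop :=
  A `<=` isolated A.

(* Isom(H^2) has the compact-open topology, which on isometries is the
   topology of pointwise convergence. *)
Definition discrete_isom_group (G : set (H -> H)) : Prop :=
  [/\ transformation_group G, G `<=` isom &
      discrete_set (G : set {ptws H -> H})].

Definition SL2 : set 'M[R]_2 := [set M | \det M = 1].

Definition acts_as (M : 'M[R]_2) (f : H -> H) : Prop :=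
  forall z, val (f z) =
    ((M 0 0)%:C * val z + (M 0 1)%:C) / ((M 1 0)%:C * val z + (M 1 1)%:C).

(* PSL_2(R) is identified with the group of Moebius transformations of H^2:
   M and N in SL2 act as the same map exactly when N = M or N = - M. *)
Definition PSL2 : set (H -> H) := [set f | exists2 M, SL2 M & acts_as M f].

Definition SL2_preimage (Gamma : set (H -> H)) : set 'M[R]_2 :=
  [set M | SL2 M /\ exists2 f, Gamma f & acts_as M f].

(* As SL_2(R) -> PSL_2(R) is a two-fold covering, a subgroup of PSL_2(R) is
   discrete when its preimage is discrete among the matrices. *)
Definition fuchsian (Gamma : set (H -> H)) : Prop :=
  [/\ transformation_group Gamma, Gamma `<=` PSL2 &
      discrete_set (SL2_preimage Gamma)].

(* The area of the quotient H^2/Gamma is that of a measurable set of orbit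
   representatives. *)
Definition finite_coarea (Gamma : set (H -> H)) : Prop :=
  exists F : set H,
    [/\ measurable (to_plane @` F),
        forall z, exists! w, F w /\ exists2 g, Gamma g & w = g z &
        (harea F < +oo)%E].

(* Semicircle c r is centered at the real number c. *)
Inductive geodesic : Type :=
| Vertical of R
| Semicircle of R & {posnum R}.

Definition side_fun (L : geodesic) (z : H) : R :=
  match L with
  | Vertical a => hRe z - a
  | Semicircle c r =>
      ComplexField.Normc.normc (val z - c%:C) ^+ 2 - r%:num ^+ 2
  end.

Definition geodesic_line (L : geodesic) : set H := [set z | side_fun L z = 0].

Definition half_plane (L : geodesic) (b : bool) : set H :=
  [set z | if b then 0 <= side_fun L z else side_fun L z <= 0].

Definition is_reflection (L : geodesic) (f : H -> H) : Prop :=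
  forall z, val (f z) =
    match L with
    | Vertical a => (2 * a)%:C - conjc (val z)
    | Semicircle c r => c%:C + (r%:num ^+ 2)%:C / (conjc (val z) - c%:C)
    end.

(* Finite intersections of closed half-planes, so closed and convex. *)
Definition polygon (P : set H) : Prop :=
  [/\ exists (n : nat) (h : 'I_n -> geodesic * bool),
        P = \bigcap_i half_plane (h i).1 (h i).2,
      P° !=set0 &
      (harea P < +oo)%E].

Definition side_of (P : set H) (L : geodesic) : Prop :=
  (exists b, P `<=` half_plane L b) /\
  exists z w, [/\ z != w, (P `&` geodesic_line L) z &
                  (P `&` geodesic_line L) w].

Definition fundamental_domain (G : set (H -> H)) (P : set H) : Prop :=
  [/\ polygon P,
      \bigcup_(g in G) (g @` P) = setT &
      forall g, G g -> g <> id -> P° `&` (g @` P°) = set0].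

Definition dirichlet_domain (Gamma : set (H -> H)) (z0 : H) : set H :=
  [set x | forall a, Gamma a -> a <> id -> hdist x z0 <= hdist x (a z0)].

Definition fixes_infty (f : H -> H) : Prop :=
  exists M, [/\ SL2 M, acts_as M f & M 1 0 = 0].

Definition parabolic (f : H -> H) : Prop :=
  f <> id /\ exists M, [/\ SL2 M, acts_as M f & `| \tr M | = 2].

Definition stab_infty (Gamma : set (H -> H)) : set (H -> H) :=
  Gamma `&` fixes_infty.

Definition outside_isometric_circle (M : 'M[R]_2) : set H :=
  [set z | 1 <= ComplexField.Normc.normc
                  ((M 1 0)%:C * val z + (M 1 1)%:C)].

Definition ford_domain (Gamma : set (H -> H)) (P : set H) : Prop :=
  (exists f, [/\ Gamma f, parabolic f & fixes_infty f]) /\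
  exists (x0 t : R) (tau : H -> H),
    [/\ 0 < t,
        forall z, val (tau z) = val z + t%:C,
        stab_infty Gamma = generated [set tau] &
        P = [set z | x0 <= hRe z <= x0 + t] `&`
            [set z | forall g M, (Gamma `\` stab_infty Gamma) g ->
                       SL2 M -> acts_as M g -> outside_isometric_circle M z]].

Definition DF_domain (Gamma : set (H -> H)) (P : set H) : Prop :=
  [/\ fundamental_domain Gamma P, ford_domain Gamma P &
      exists z0, P = dirichlet_domain Gamma z0].

Definition double_dirichlet_domain (Gamma : set (H -> H)) (P : set H) : Prop :=
  fundamental_domain Gamma P /\
  exists z0 z1, [/\ z0 <> z1, P = dirichlet_domain Gamma z0 &
                    P = dirichlet_domain Gamma z1].

Definition reflections_in_sides (Q : set H) : set (H -> H) :=
  [set f | exists2 L, side_of Q L & is_reflection L f].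

(* The translates of Q tessellate the plane: fundamental_domain G Q. *)
Definition discrete_reflection_group (Q : set H) (G : set (H -> H)) : Prop :=
  [/\ G = generated (reflections_in_sides Q),
      discrete_isom_group G & fundamental_domain G Q].

End HyperbolicPlane.

(* Main.v *)
Require Import Defs.
From mathcomp Require Import all_boot all_order all_algebra.
From mathcomp Require Import finmap.
From mathcomp Require Import all_classical all_reals all_analysis.
From mathcomp.real_closed Require Import complex.
From mathcomp Require Import ring lra.

(* In the coordinates (1/y, x/y, (x^2+y^2)/y) the plane is a sheet of a
   hyperboloid, isometries are linear, and geodesics and bisectors are zero sets
   of linear forms.

   Let P be the Dirichlet domain centered at z0 and m the midpoint of two points
   of a side L' of P. Local finiteness gives a <> 1 in Gamma with m equidistant
   from z0 and a z0; the form of that bisector is nonnegative on P and vanishes at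
   m, hence on all of L', so the reflection s in L' maps z0 to a z0. As m lies in
   both P and a P, the same a works for a second center z1, and in the Ford case
   for the boundary form of the Ford domain through m. So a^-1 s reverses
   orientation and fixes z0 and z1 (resp. z0 and infinity): it is the reflection
   rho in the geodesic L joining these two points, and s = a rho for every side.

   Moving points closer to z0 by such reflections shows that rho normalizes Gamma.
   Then G = Gamma u Gamma rho contains Gamma with index 2, the half Q of P on one
   side of L is a fundamental domain for G, and the same descent shows that the
   reflections in the sides of Q generate G. *)

Set Implicit Arguments.
Unset Strict Implicit.
Unset Printing Implicit Defensive.

Import Order.TTheory GRing.Theory Num.Theory.
Import numFieldNormedType.Exports.
Local Open Scope classical_set_scope.
Local Open Scope ring_scope.
Local Open Scope complex_scope.
Local Open Scope card_scope.

(** * Hyperboloid coordinates *)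

Section Hyperboloid.
Variable R : realType.
Local Notation H := (UHP R).
Implicit Types (z w m : H) (f g : H -> H) (L : geodesic R).

Definition hU z : R := (hIm z)^-1.
Definition hV z : R := hRe z / hIm z.
Definition hW z : R := (hRe z ^+ 2 + hIm z ^+ 2) / hIm z.

Lemma hIm_gt0 z : 0 < hIm z.
Proof. by case: z. Qed.

Lemma hIm_neq0 z : hIm z != 0.
Proof. exact: lt0r_neq0 (hIm_gt0 z). Qed.
Hint Resolve hIm_gt0 hIm_neq0 : core.

Lemma hU_gt0 z : 0 < hU z.
Proof. by rewrite invr_gt0. Qed.

Lemma hUVW z : hU z * hW z - hV z ^+ 2 = 1.
Proof. rewrite /hU /hV /hW; field; exact: hIm_neq0. Qed.

Lemma hW_gt0 z : 0 < hW z.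
Proof.
have := hUVW z; have := hU_gt0 z => u0 e.
rewrite -(pmulr_rgt0 _ u0); have := sqr_ge0 (hV z); lra.
Qed.

Lemma UHP_eq z w : hRe z = hRe w -> hIm z = hIm w -> z = w.
Proof.
move=> e1 e2; apply: val_inj; apply/eqP; rewrite eq_complex.
by apply/andP; split; apply/eqP.
Qed.

Lemma hUV_inj z w : hU z = hU w -> hV z = hV w -> z = w.
Proof.
rewrite /hU /hV => /invr_inj e1; rewrite e1 => e2.
apply: UHP_eq => //; apply: (mulIf (x := (hIm w)^-1)) => //.
by rewrite invr_eq0.
Qed.

Lemma UHP_ex (x y : R) : 0 < y -> exists z, hRe z = x /\ hIm z = y.
Proof.
move=> y0; have h : 0 < complex.Im (x +i* y) by [].
by exists (exist _ (x +i* y) h).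
Qed.

Lemma hyperboloid_ex (u v w : R) : 0 < u -> u * w - v ^+ 2 = 1 ->
  exists z, [/\ hU z = u, hV z = v & hW z = w].
Proof.
move=> u0 e; have u1 : u != 0 by exact: lt0r_neq0.
have [|z [zx zy]] := @UHP_ex (v / u) u^-1; first by rewrite invr_gt0.
exists z; rewrite /hU /hV /hW zx zy; split; first by rewrite invrK.
  by field.
have -> : w = (1 + v ^+ 2) / u by rewrite -e; field.
by field.
Qed.

(* cosh of the hyperbolic distance *)
Definition chd z w : R := (hU z * hW w + hW z * hU w - 2 * hV z * hV w) / 2.

Lemma chdC z w : chd z w = chd w z.
Proof. by rewrite /chd; lra. Qed.

Lemma chdE z w : chd z w =
  ((hRe z - hRe w) ^+ 2 + hIm z ^+ 2 + hIm w ^+ 2) / (2 * hIm z * hIm w).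
Proof.
rewrite /chd /hU /hV /hW; field.
by rewrite !hIm_neq0.
Qed.

Lemma normc_sqr (z : R[i]) :
  ComplexField.Normc.normc z ^+ 2 = complex.Re z ^+ 2 + complex.Im z ^+ 2.
Proof. by case: z => a b /=; rewrite sqr_sqrtr // addr_ge0 ?sqr_ge0. Qed.

Lemma hdistE z w : hdist z w = arcosh (chd z w).
Proof.
rewrite /hdist normc_sqr chdE; congr arcosh.
rewrite !raddfB /= -/(hRe z) -/(hRe w) -/(hIm z) -/(hIm w); field.
by rewrite !hIm_neq0.
Qed.

Lemma chd_ge1 z w : 1 <= chd z w.
Proof.
rewrite chdE ler_pdivlMr ?mulr_gt0 //.
have := sqr_ge0 (hRe z - hRe w); have := sqr_ge0 (hIm z - hIm w); nra.
Qed.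

Lemma chdzz z : chd z z = 1.
Proof. by have := hUVW z; rewrite /chd; lra. Qed.

Lemma chd_le1 z w : chd z w <= 1 -> z = w.
Proof.
rewrite chdE ler_pdivrMr ?mulr_gt0 // => h.
have s1 := sqr_ge0 (hRe z - hRe w); have s2 := sqr_ge0 (hIm z - hIm w).
have e1 : (hRe z - hRe w) ^+ 2 = 0 by nra.
have e2 : (hIm z - hIm w) ^+ 2 = 0 by nra.
by apply: UHP_eq; apply/eqP; rewrite -subr_eq0 -sqrf_eq0; apply/eqP.
Qed.

Lemma ltr_arcosh (u v : R) : 1 <= u -> u < v -> arcosh u < arcosh v.
Proof.
move=> u1 uv; have v1 : 1 <= v by lra.
rewrite /arcosh ltr_ln ?posrE; first last.
- by have := sqrtr_ge0 (v ^+ 2 - 1); lra.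
- by have := sqrtr_ge0 (u ^+ 2 - 1); lra.
by apply: ltr_leD => //; apply: ler_wsqrtr; nra.
Qed.

(** [arcosh] is strictly increasing on [1, oo), so all comparisons of distances become comparisons
    of [chd], which is bilinear in the coordinates. *)
Lemma ler_hdist z w z' w' : (hdist z w <= hdist z' w') = (chd z w <= chd z' w').
Proof.
rewrite !hdistE; apply/idP/idP; last first.
  rewrite le_eqVlt => /orP[/eqP->//|h].
  by apply/ltW/ltr_arcosh => //; exact: chd_ge1.
by apply: contraTT; rewrite -!ltNge => h; apply: ltr_arcosh => //; exact: chd_ge1.
Qed.

Definition lin (p q r : R) z : R := p * hU z + q * hV z + r * hW z.

(** Up to the positive factor [hU z], a linear form is the Euclidean equation of a circle centered
    on the real axis or of a vertical line. *)
Lemma lin_sign p q r z :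
  lin p q r z = hU z * (p + q * hRe z + r * (hRe z ^+ 2 + hIm z ^+ 2)).
Proof. by rewrite /lin /hU /hV /hW; field; exact: hIm_neq0. Qed.

(* Real matrices (a b; c d) with determinant 1 act on the plane by z |-> gz,
   those with determinant -1 by z |-> g(conj z); in the coordinates
   (hU, hV, hW) both actions are S |-> M S M^T on symmetric matrices. *)
Definition moebius (a b c d : R) f :=
  forall z, [/\ hU (f z) = c ^+ 2 * hW z + 2 * c * d * hV z + d ^+ 2 * hU z,
    hV (f z) = a * c * hW z + (a * d + b * c) * hV z + b * d * hU z &
    hW (f z) = a ^+ 2 * hW z + 2 * a * b * hV z + b ^+ 2 * hU z].

Lemma moebius_comp a b c d a' b' c' d' f g :
  moebius a b c d f -> moebius a' b' c' d' g ->
  moebius (a * a' + b * c') (a * b' + b * d') (c * a' + d * c') (c * b' + d * d')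
    (f \o g).
Proof.
move=> hf hg z; have [f1 f2 f3] := hf (g z); have [g1 g2 g3] := hg z.
by rewrite /= f1 f2 f3 g1 g2 g3; split; ring.
Qed.

Lemma moebius_eq a b c d a' b' c' d' (e : R) f g : e ^+ 2 = 1 ->
  moebius a b c d f -> moebius a' b' c' d' g ->
  a' = e * a -> b' = e * b -> c' = e * c -> d' = e * d -> f = g.
Proof.
move=> e1 hf hg ea eb ec ed; apply/funext => z.
have [f1 f2 _] := hf z; have [g1 g2 _] := hg z.
by apply: hUV_inj; rewrite ?f1 ?f2 ?g1 ?g2 ?ea ?eb ?ec ?ed; ring: e1.
Qed.

(** [chd] is the polarization of the determinant [hU * hW - hV ^+ 2], which S |-> M S M^T multiplies
    by (det M)^2. *)
Lemma moebius_chd a b c d f z w : (a * d - b * c) ^+ 2 = 1 ->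
  moebius a b c d f -> chd (f z) (f w) = chd z w.
Proof.
move=> e hf; have [f1 f2 f3] := hf z; have [g1 g2 g3] := hf w.
transitivity ((a * d - b * c) ^+ 2 * chd z w); last by rewrite e mul1r.
by rewrite /chd f1 f2 f3 g1 g2 g3; field.
Qed.

(** The reflection in [L] is given by the matrix (gA gB; gC -gA), of trace 0 and, by [gE], of
    determinant -1. *)
Definition gA L := match L with Vertical _ => -1 | Semicircle c r => c / r%:num end.
Definition gB L := match L with
  Vertical x => 2 * x | Semicircle c r => (r%:num ^+ 2 - c ^+ 2) / r%:num end.
Definition gC L := match L with Vertical _ => 0 | Semicircle c r => r%:num^-1 end.

Lemma gE L : gA L ^+ 2 + gB L * gC L = 1.
Proof. by case: L => [x|c r] /=; field. Qed.

(** Clearing denominators in the fixed point equation of the reflection gives c|z|^2 - 2a Re z - b =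
    0; this form is the left side times [hU z]. *)
Definition gphi L := lin (- gB L) (- (2 * gA L)) (gC L).

Lemma gphi_side L z : exists2 k, 0 < k & gphi L z = k * side_fun L z.
Proof.
case: L => [x|c r].
  exists (2 * hU z); first by rewrite mulr_gt0 // hU_gt0.
  by rewrite /gphi lin_sign /=; ring.
exists (hU z / r%:num); first by rewrite divr_gt0 // hU_gt0.
rewrite /gphi lin_sign /= normc_sqr !raddfB /= -/(hRe z) -/(hIm z).
by field.
Qed.

Lemma gphi0 L z : geodesic_line L z <-> gphi L z = 0.
Proof.
have [k k0 ->] := gphi_side L z; rewrite /geodesic_line /=.
split=> [->|/eqP]; first by rewrite mulr0.
by rewrite mulf_eq0 gt_eqF //= => /eqP.
Qed.

Definition sgn (b : bool) (x : R) := if b then x else - x.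

Lemma half_planeE L b z : half_plane L b z <-> 0 <= sgn b (gphi L z).
Proof.
have [k k0 ->] := gphi_side L z; rewrite /half_plane /sgn /=.
by case: b; rewrite ?oppr_ge0 ?pmulr_rge0 ?pmulr_rle0.
Qed.

Lemma is_reflectionP L f : is_reflection L f ->
  moebius (gA L) (gB L) (gC L) (- gA L) f.
Proof.
move=> h z.
case: L h => [x|c r] /= /(_ z) h.
  have e1 : hRe (f z) = 2 * x - hRe z.
    by rewrite /hRe h; case: (val z).
  have e2 : hIm (f z) = hIm z.
    by rewrite /hIm h; case: (val z) => a b /=; ring.
  by rewrite /hU /hV /hW e1 e2; split; field; exact: hIm_neq0.
have y0 := hIm_neq0 z.
have n0 : (hRe z - c) ^+ 2 + hIm z ^+ 2 != 0.
  by rewrite gt_eqF // ltr_wpDl ?sqr_ge0 // exprn_gt0.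
have e1 : hRe (f z) = c + r%:num ^+ 2 * (hRe z - c) / ((hRe z - c) ^+ 2 + hIm z ^+ 2).
  move: n0; rewrite /hRe /hIm h; case: (val z) => a b /= n0; field.
  by move: n0; rewrite ?oppr0 ?addr0 ?subr0 ?sqrrN.
have e2 : hIm (f z) = r%:num ^+ 2 * hIm z / ((hRe z - c) ^+ 2 + hIm z ^+ 2).
  move: n0; rewrite /hRe /hIm h; case: (val z) => a b /= n0; field.
  by move: n0; rewrite ?oppr0 ?addr0 ?subr0 ?sqrrN.
rewrite /hU /hV /hW e1 e2.
by split; field; apply/and3P; split=> //; try exact: y0; exact: n0.
Qed.

Lemma det_mx2 (M : 'M[R]_2) : \det M = M 0 0 * M 1 1 - M 0 1 * M 1 0.
Proof.
rewrite (expand_det_row _ 0) !big_ord_recl big_ord0 addr0 /cofactor !det_mx11 !mxE.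
rewrite /= !expr0 expr1 mul1r mulN1r mulrN.
by congr (_ * M _ _ - M _ _ * M _ _); apply: val_inj.
Qed.

Lemma acts_as_moebius (M : 'M[R]_2) f : \det M = 1 -> acts_as M f ->
  moebius (M 0 0) (M 0 1) (M 1 0) (M 1 1) f.
Proof.
rewrite det_mx2 => dM h z; move: (h z) dM.
move: (M 0 0) (M 0 1) (M 1 0) (M 1 1) => a b c d {}h dM.
have y0 := hIm_gt0 z.
have n0 : (c * hRe z + d) ^+ 2 + (c * hIm z) ^+ 2 != 0.
  rewrite paddr_eq0 ?sqr_ge0 // !sqrf_eq0 mulf_eq0 (gt_eqF y0) orbF.
  apply/negP => /andP[/[swap] /eqP c0]; rewrite c0 mul0r add0r => /eqP d0.
  by move: dM; rewrite c0 d0 !mulr0 subrr => /esym /eqP; rewrite oner_eq0.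
have e1 : hRe (f z) = ((a * hRe z + b) * (c * hRe z + d) + a * c * hIm z ^+ 2)
    / ((c * hRe z + d) ^+ 2 + (c * hIm z) ^+ 2).
  move: n0; rewrite /hRe /hIm h; case: (val z) => x y /= n0; field.
  by move: n0; rewrite ?oppr0 ?mul0r ?addr0 ?subr0 ?add0r.
have e2 : hIm (f z) = hIm z / ((c * hRe z + d) ^+ 2 + (c * hIm z) ^+ 2).
  rewrite -[X in X / _]mul1r -{1}dM.
  move: n0; rewrite /hRe /hIm h; case: (val z) => x y /= n0; field.
  by move: n0; rewrite ?oppr0 ?mul0r ?addr0 ?subr0 ?add0r.
have y1 := lt0r_neq0 y0.
have -> : a ^+ 2 * hW z + 2 * a * b * hV z + b ^+ 2 * hU z =
   (((a * hRe z + b) ^+ 2 + (a * hIm z) ^+ 2) / hIm z) by rewrite /hU /hV /hW; field.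
have eW : hRe (f z) ^+ 2 + hIm (f z) ^+ 2 = ((a * hRe z + b) ^+ 2 + (a * hIm z) ^+ 2)
    / ((c * hRe z + d) ^+ 2 + (c * hIm z) ^+ 2).
  rewrite e1 e2 -[X in _ + (X / _) ^+ 2 = _]mul1r -{1}dM; field; exact: n0.
rewrite /hW eW /hU /hV e1 e2.
by split; field; apply/andP; split; try exact: y1; exact: n0.
Qed.

Lemma reflection_ex L : exists f, is_reflection L f.
Proof.
suff /choice[f hf] : forall z, exists w, val w = match L with
    | Vertical a => (2 * a)%:C - conjc (val z)
    | Semicircle c r => c%:C + (r%:num ^+ 2)%:C / (conjc (val z) - c%:C)
    end by exists f.
move=> z; case: L => [x|c r].
  have h : 0 < complex.Im ((2 * x)%:C - conjc (val z)).
    by have := hIm_gt0 z; rewrite /hIm; case: (val z) => a b /=; lra.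
  by exists (exist (fun u : R[i] => is_true (0 < complex.Im u)) _ h).
have h : 0 < complex.Im (c%:C + (r%:num ^+ 2)%:C / (conjc (val z) - c%:C)).
  have y0 := hIm_gt0 z.
  have n0 : 0 < (hRe z - c) ^+ 2 + hIm z ^+ 2.
    by rewrite ltr_wpDl ?sqr_ge0 // exprn_gt0.
  have -> : complex.Im (c%:C + (r%:num ^+ 2)%:C / (conjc (val z) - c%:C)) =
     r%:num ^+ 2 * hIm z / ((hRe z - c) ^+ 2 + hIm z ^+ 2).
    move: n0; rewrite /hRe /hIm; case: (val z) => a b /= n0; field.
    by apply: lt0r_neq0; move: n0; rewrite ?oppr0 ?addr0 ?subr0 ?sqrrN.
  by rewrite divr_gt0 // mulr_gt0.
by exists (exist (fun u : R[i] => is_true (0 < complex.Im u)) _ h).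
Qed.

Section Reflection.
Variables (L : geodesic R) (f : H -> H).
Hypothesis fL : is_reflection L f.

(** As for a hyperplane reflection, the point moves along the fixed normal vector (gC, gA, -gB) of
    [L], by the value of the form of [L]. *)
Lemma reflE z : [/\ hU (f z) = hU z + gC L * gphi L z,
  hV (f z) = hV z + gA L * gphi L z & hW (f z) = hW z - gB L * gphi L z].
Proof.
have [-> -> ->] := is_reflectionP fL z.
have : gA L ^+ 2 = 1 - gB L * gC L by rewrite -(gE L) addrK.
rewrite /gphi /lin; move: (gA L) (gB L) (gC L) => a b c e.
by split; [ring: e | ring: e | ring: e].
Qed.

Lemma refl_phi z : gphi L (f z) = - gphi L z.
Proof.
have [e1 e2 e3] := reflE z; rewrite {1}/gphi /lin e1 e2 e3.
transitivity (gphi L z - 2 * (gA L ^+ 2 + gB L * gC L) * gphi L z).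
  by rewrite /gphi /lin; ring.
by rewrite gE; ring.
Qed.

Lemma refl_fix z : gphi L z = 0 -> f z = z.
Proof.
by move=> e; have [e1 e2 _] := reflE z; apply: hUV_inj; rewrite ?e1 ?e2 e mulr0 addr0.
Qed.

Lemma reflK : cancel f f.
Proof.
move=> z; have [e1 e2 _] := reflE (f z); have [e3 e4 _] := reflE z.
by apply: hUV_inj; rewrite ?e1 ?e2 ?e3 ?e4 refl_phi; ring.
Qed.

Lemma refl_chd z w : chd (f z) (f w) = chd z w.
Proof.
apply: moebius_chd (is_reflectionP fL).
have -> : gA L * - gA L - gB L * gC L = - (gA L ^+ 2 + gB L * gC L) by ring.
by rewrite gE sqrrN expr1n.
Qed.

(* A reflection brings z closer to every point on the other side of its axis. *)
Lemma refl_chd_sub z w : chd (f z) w = chd z w + gphi L z * gphi L w / 2.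
Proof.
have [e1 e2 e3] := reflE z; by rewrite /chd e1 e2 e3 [gphi L w]/gphi /lin; field.
Qed.

End Reflection.

(** Distinct points of the sheet are linearly independent vectors, so the forms vanishing at both
    are the multiples of any nonzero one. The proof divides by [r'], or by [q'] when the points lie
    on a vertical line. *)
Lemma lin_prop z w p q r p' q' r' : z <> w ->
  lin p q r z = 0 -> lin p q r w = 0 -> lin p' q' r' z = 0 -> lin p' q' r' w = 0 ->
  (p', q', r') != (0, 0, 0) ->
  exists k, [/\ p = k * p', q = k * q' & r = k * r'].
Proof.
pose s := hRe z ^+ 2 + hIm z ^+ 2; pose t := hRe w ^+ 2 + hIm w ^+ 2.
move=> zw; rewrite !lin_sign -/s -/t.
have P (c d : R) : 0 < c -> c * d = 0 -> d = 0.
  by move=> c0 /eqP; rewrite mulf_eq0 (gt_eqF c0) => /eqP.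
move=> /(P _ _ (hU_gt0 _)) h1 /(P _ _ (hU_gt0 _)) h2.
move=> /(P _ _ (hU_gt0 _)) h3 /(P _ _ (hU_gt0 _)) h4 n0.
have yz := hIm_gt0 z; have yw := hIm_gt0 w.
have [xe|xne] := eqVneq (hRe z) (hRe w); last first.
  have d0 : hRe z - hRe w != 0 by rewrite subr_eq0.
  have eq1 (a b c : R) : a + b * hRe z + c * s = 0 -> a + b * hRe w + c * t = 0 ->
     b = - c * (s - t) / (hRe z - hRe w) by move=> k1 k2; apply: (mulIf d0); rewrite divfK //; lra.
  have qe := eq1 _ _ _ h1 h2; have qe' := eq1 _ _ _ h3 h4.
  have pe : p = - q * hRe z - r * s by lra.
  have pe' : p' = - q' * hRe z - r' * s by lra.
  have r0 : r' != 0.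
    apply: contra n0 => /eqP r0; rewrite pe' qe' r0; apply/eqP; congr (_, _, _); field; exact: d0.
  exists (r / r'); rewrite pe pe' qe qe'; split; field; by rewrite ?d0 ?r0.
have st : s != t.
  apply/eqP => st; apply: zw; apply: UHP_eq => //.
  have : (hIm z - hIm w) * (hIm z + hIm w) = 0.
    by move: st; rewrite /s /t xe => /addrI; nra.
  by move=> /eqP; rewrite mulf_eq0 (gt_eqF (addr_gt0 yz yw)) orbF subr_eq0 => /eqP.
have z0 (a b c : R) : a + b * hRe z + c * s = 0 -> a + b * hRe w + c * t = 0 -> c = 0.
  rewrite xe => k1 k2; have : c * (s - t) = 0 by lra.
  by move=> /eqP; rewrite mulf_eq0 subr_eq0 (negbTE st) orbF => /eqP.
have r0 := z0 _ _ _ h1 h2; have r0' := z0 _ _ _ h3 h4.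
have pe : p = - q * hRe z by move: h1; rewrite r0; lra.
have pe' : p' = - q' * hRe z by move: h3; rewrite r0'; lra.
have q0 : q' != 0.
  by apply: contra n0 => /eqP q0; rewrite pe' r0' q0; apply/eqP; congr (_, _, _); ring.
by exists (q / q'); rewrite pe pe' r0 r0'; split; field; rewrite ?q0.
Qed.

Lemma gphi_neq0 L : (- gB L, - (2 * gA L), gC L) != (0, 0, 0).
Proof.
apply/eqP => -[e1 e2 e3]; have := gE L.
have -> : gA L = 0 by lra.
by rewrite e3; lra.
Qed.

(** The scalar relating the two forms is a sign because [gE] normalizes both. *)
Lemma geodesic_eq L L' z w : z <> w ->
  gphi L z = 0 -> gphi L w = 0 -> gphi L' z = 0 -> gphi L' w = 0 ->
  exists e, [/\ e ^+ 2 = 1, gA L' = e * gA L, gB L' = e * gB L & gC L' = e * gC L].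
Proof.
move=> zw h1 h2 h3 h4.
have [e [e1 e2 e3]] := lin_prop zw h3 h4 h1 h2 (gphi_neq0 L).
have eA : gA L' = e * gA L by lra.
have eB : gB L' = e * gB L by lra.
exists e; split => //; have := gE L'; rewrite eA eB e3.
by have := gE L => E E'; rewrite -E' -[LHS]mulr1 -{}E; ring.
Qed.

Lemma reflection_eq L L' f g z w : z <> w ->
  gphi L z = 0 -> gphi L w = 0 -> gphi L' z = 0 -> gphi L' w = 0 ->
  is_reflection L f -> is_reflection L' g -> f = g.
Proof.
move=> zw h1 h2 h3 h4 fL gL.
have [e [e1 eA eB eC]] := geodesic_eq zw h1 h2 h3 h4.
apply: (moebius_eq e1 (is_reflectionP fL) (is_reflectionP gL)) => //.
by rewrite eA mulrN.
Qed.

Lemma geodesic_ex z w : exists L, gphi L z = 0 /\ gphi L w = 0.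
Proof.
have [xe|xne] := eqVneq (hRe z) (hRe w).
  exists (Vertical (hRe z)); rewrite -!gphi0 /geodesic_line /=.
  by rewrite xe subrr.
have d0 : 2 * (hRe w - hRe z) != 0.
  by rewrite mulf_neq0 ?pnatr_eq0 // subr_eq0 eq_sym.
(* The real point at equal Euclidean distance from [z] and [w]. *)
pose c := (hRe w ^+ 2 + hIm w ^+ 2 - (hRe z ^+ 2 + hIm z ^+ 2)) / (2 * (hRe w - hRe z)).
have ce : c * (2 * (hRe w - hRe z)) =
   hRe w ^+ 2 + hIm w ^+ 2 - (hRe z ^+ 2 + hIm z ^+ 2) by rewrite /c divfK.
have n0 : 0 < (hRe z - c) ^+ 2 + hIm z ^+ 2.
  by rewrite ltr_wpDl ?sqr_ge0 // exprn_gt0.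
have r0 : 0 < Num.sqrt ((hRe z - c) ^+ 2 + hIm z ^+ 2) by rewrite sqrtr_gt0.
exists (Semicircle c (PosNum r0)); rewrite -!gphi0 /geodesic_line /= !normc_sqr.
rewrite !raddfB /= -/(hRe z) -/(hIm z) -/(hRe w) -/(hIm w) sqr_sqrtr ?ltW // subr0.
by split; [rewrite subrr | rewrite ?subr0; nra].
Qed.

(* Hyperbolic segments are affine segments in the coordinates (hU, hV, hW),
   up to a positive factor. *)
Lemma segment_ex z w (s t : R) : 0 <= s -> 0 <= t -> 0 < s + t ->
  exists m, exists2 k, 0 < k &
    forall p q r, lin p q r m = k * (s * lin p q r z + t * lin p q r w).
Proof.
move=> s0 t0 st.
have uz := hU_gt0 z; have uw := hU_gt0 w; have ez := hUVW z; have ew := hUVW w.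
have c1 : 1 <= chd z w := chd_ge1 z w.
(* The determinant of the combination s z + t w; dividing by its square root returns to the
   sheet. *)
pose n := s ^+ 2 + t ^+ 2 + 2 * s * t * chd z w.
have n0 : 0 < n.
  have : 0 < (s + t) ^+ 2 by rewrite exprn_gt0.
  have : 0 <= s * t * (chd z w - 1) by rewrite !mulr_ge0 // subr_ge0.
  rewrite /n; nra.
pose k := (Num.sqrt n)^-1.
have k0 : 0 < k by rewrite invr_gt0 sqrtr_gt0.
have kn : k ^+ 2 * n = 1.
  by rewrite /k exprVn sqr_sqrtr ?ltW // mulVf // gt_eqF.
have [||m [mU mV mW]] := @hyperboloid_ex (k * (s * hU z + t * hU w))
  (k * (s * hV z + t * hV w)) (k * (s * hW z + t * hW w)).
- rewrite mulr_gt0 //; have [s1|s1] := ltP 0 s.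
    by rewrite ltr_pwDl ?mulr_gt0 // mulr_ge0 // ltW.
  have -> : s = 0 by lra.
  by rewrite mul0r add0r mulr_gt0 //; lra.
- have ez' : hV z ^+ 2 = hU z * hW z - 1 by rewrite -ez subKr.
  have ew' : hV w ^+ 2 = hU w * hW w - 1 by rewrite -ew subKr.
  by rewrite -[RHS]kn /n /chd; field: ez' ew'.
by exists m; exists k => // p q r; rewrite /lin mU mV mW; ring.
Qed.

End Hyperboloid.

(** * Topology of the half-plane, bisectors and minima *)

Section Topology.
Variable R : realType.
Local Notation H := (UHP R).
Implicit Types (z w : H) (A : set H).

Lemma hRe_continuous : continuous (@hRe R).
Proof.
move=> z; apply: (@cvg_comp _ _ _ (@to_plane R : initial_topology _ -> _) fst).
  exact: initial_continuous.
exact: cvg_fst.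
Qed.

Lemma hIm_continuous : continuous (@hIm R).
Proof.
move=> z; apply: (@cvg_comp _ _ _ (@to_plane R : initial_topology _ -> _) snd).
  exact: initial_continuous.
exact: cvg_snd.
Qed.

Lemma nbhs_boxP z A : nbhs z A -> exists2 e : R, 0 < e &
  forall w, `|hRe w - hRe z| < e -> `|hIm w - hIm z| < e -> A w.
Proof.
rewrite nbhsE => -[U [[V oV VU] Uz] UA].
have : nbhs (to_plane z) V by apply: open_nbhs_nbhs; split=> //; rewrite -VU in Uz.
move=> /nbhs_ballP[e /= e0 eV]; exists e => // w h1 h2; apply: UA; rewrite -VU.
by apply: eV; split; rewrite /ball /= distrC.
Qed.

Lemma lin_near p q r z : 0 < lin p q r z -> \forall w \near z, 0 < lin p q r w.
Proof.
rewrite lin_sign pmulr_rgt0 ?hU_gt0 // => h.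
suff : \forall w \near z, 0 < p + q * hRe w + r * (hRe w ^+ 2 + hIm w ^+ 2).
  by apply: filterS => w; rewrite lin_sign pmulr_rgt0 // hU_gt0.
have cR := @hRe_continuous z; have cI := @hIm_continuous z.
pose F w := p + q * hRe w + r * (hRe w ^+ 2 + hIm w ^+ 2).
have hF : F w @[w --> z] --> F z.
  refine (cvgD (cvgD (cvg_cst p) (cvgM (cvg_cst q) cR)) (cvgM (cvg_cst r) _)).
  exact (cvgD (cvgM cR cR) (cvgM cI cI)).
by move: h; apply: (cvgr_gt _ hF).
Qed.

(** At an interior zero of the form, a small vertical step against the sign of [r] makes it
    negative; if [r] is 0, a horizontal step against the sign of [q] does; if both are 0, so is
    [p]. *)
Lemma interior_lin_gt0 A p q r z : A° z -> (forall w, A w -> 0 <= lin p q r w) ->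
  (p, q, r) != (0, 0, 0) -> 0 < lin p q r z.
Proof.
move=> /nbhs_boxP[e e0 eA] Age n0.
have y0 := hIm_gt0 z.
have P w : `|hRe w - hRe z| < e -> `|hIm w - hIm z| < e ->
    0 <= p + q * hRe w + r * (hRe w ^+ 2 + hIm w ^+ 2).
  by move=> h1 h2; have := Age _ (eA _ h1 h2); rewrite lin_sign pmulr_rge0 // hU_gt0.
have a0 : `|0 : R| < e by rewrite normr0.
have : 0 <= lin p q r z.
  by apply: Age; apply: eA; rewrite subrr.
rewrite le_eqVlt => /orP[/eqP|//]; rewrite lin_sign => /esym/eqP.
rewrite mulf_eq0 (gt_eqF (hU_gt0 _)) /= => /eqP z0.
have Q (x y : R) : `|x - hRe z| < e -> `|y - hIm z| < e -> 0 < y ->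
    0 <= p + q * x + r * (x ^+ 2 + y ^+ 2).
  by move=> h1 h2 /(UHP_ex x)[w [wx wy]]; rewrite -wx -wy; apply: P; rewrite ?wx ?wy.
pose d := Num.min e (hIm z) / 2.
have d0 : 0 < d by rewrite /d divr_gt0 // lt_min e0.
have [de dy] : d < e /\ d < hIm z.
  have : Num.min e (hIm z) <= e by rewrite ge_min lexx.
  have : Num.min e (hIm z) <= hIm z by rewrite ge_min lexx orbT.
  by rewrite /d; lra.
have dn : `|d| < e by rewrite gtr0_norm.
have [r0|r0|r0] := ltgtP r 0.
- have := Q (hRe z) (hIm z + d); rewrite subrr addrAC subrr add0r => /(_ a0 dn).
  have k : 0 < d * (2 * hIm z + d) by rewrite mulr_gt0 //; lra.
  by move=> /(_ (addr_gt0 y0 d0)); have : r * (d * (2 * hIm z + d)) < 0; [rewrite nmulr_rlt0|nra].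
- have := Q (hRe z) (hIm z - d); rewrite subrr addrAC subrr add0r normrN => /(_ a0 dn).
  have k : 0 < d * (2 * hIm z - d) by rewrite mulr_gt0 //; lra.
  by rewrite subr_gt0 => /(_ dy); have : 0 < r * (d * (2 * hIm z - d)); [rewrite mulr_gt0|nra].
have [q0|q0|q0] := ltgtP q 0.
- have := Q (hRe z + d) (hIm z); rewrite subrr addrAC subrr add0r => /(_ dn a0 y0).
  by rewrite r0; nra.
- have := Q (hRe z - d) (hIm z); rewrite subrr addrAC subrr add0r normrN => /(_ dn a0 y0).
  by rewrite r0; nra.
by move: z0 n0; rewrite r0 q0 !mul0r !addr0 => ->; rewrite eqxx.
Qed.

Definition bis z w := lin (hW w - hW z) (- (2 * (hV w - hV z))) (hU w - hU z).

Lemma bisE z w x : bis z w x = 2 * (chd x w - chd x z).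
Proof. by rewrite /bis /lin /chd; field. Qed.

Lemma bis_neq0 z w : z <> w ->
  (hW w - hW z, - (2 * (hV w - hV z)), hU w - hU z) != (0, 0, 0).
Proof.
move=> zw; apply/eqP => -[e1 e2 e3]; apply: zw; apply: hUV_inj; lra.
Qed.

(** The bisector form is a multiple [k] of the form of [L], so [w] is [z] plus [k] times the normal
    vector of [L]. As both lie on the sheet, [k] is 0, excluded by [z <> w], or [gphi L z], which is
    [reflE]. *)
Lemma bis_reflection L f z w x y : is_reflection L f -> z <> w -> x <> y ->
  gphi L x = 0 -> gphi L y = 0 -> bis z w x = 0 -> bis z w y = 0 -> f z = w.
Proof.
move=> fL zw xy x0 y0 bx by0.
have [k [e1 e2 e3]] := lin_prop xy bx by0 x0 y0 (gphi_neq0 L).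
have [f1 f2 _] := reflE fL z.
have eU : hU w = hU z + k * gC L by lra.
have eV : hV w = hV z + k * gA L by lra.
have eW : hW w = hW z - k * gB L by lra.
have : k * (gphi L z - k * (gA L ^+ 2 + gB L * gC L)) = 0.
  have h1 := hUVW z; have h2 := hUVW w.
  rewrite -[RHS](subrr 1) -{1}h2 -h1 eU eV eW /gphi /lin; ring.
rewrite gE mulr1 => /eqP; rewrite mulf_eq0 => /orP[/eqP k0|/eqP ek].
  by case: zw; apply: hUV_inj; rewrite ?eU ?eV k0; ring.
by apply: hUV_inj; rewrite ?f1 ?f2 ?eU ?eV (subr0_eq ek); ring.
Qed.

(** This starts both descents: only the finitely many elements not above [t0] compete. *)
Lemma exists_min (T : choiceType) (A : set T) (f : T -> R) t0 : A t0 ->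
  finite_set (A `&` [set t | f t <= f t0]) ->
  exists2 t, A t & forall s, A s -> f t <= f s.
Proof.
move=> At0 /finite_seqP[s sE].
have [t ts tmin] : exists2 t, t \in s & forall u, u \in s -> f t <= f u.
  have : t0 \in s by have : [set` s] t0 by rewrite -sE; split=> //=.
  elim: s {sE At0} t0 => // a s IH t0 _.
  case: s IH => [|b s] IH.
    by exists a; rewrite ?inE // => u; rewrite inE => /eqP ->.
  have [|t ts tm] := IH b; first by rewrite inE eqxx.
  have [h|h] := leP (f a) (f t).
    exists a; first by rewrite inE eqxx.
    move=> u; rewrite in_cons => /orP[/eqP->//|us].
    by apply: le_trans h (tm _ us).
  exists t; first by rewrite in_cons ts orbT.
  by move=> u; rewrite in_cons => /orP[/eqP->|/tm//]; exact: ltW.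
have [At tle] : (A `&` [set t | f t <= f t0]) t by rewrite sE.
exists t => // u Au; have [h|h] := leP (f u) (f t0).
  by apply: tmin; have : [set` s] u by rewrite -sE.
by apply: le_trans tle (ltW h).
Qed.

End Topology.

(** * Local finiteness of orbits *)

Section Discreteness.
Variable R : realType.
Local Notation H := (UHP R).
Implicit Types (z w p : H) (f g : H -> H).

(** Completing the square, 2 U U' chd = U^2 + U'^2 + (U V' - V U')^2, and likewise with W in place
    of U. *)
Lemma chd_bound z w C : chd z w <= C -> hU w <= 2 * C * hU z /\ hW w <= 2 * C * hW z.
Proof.
move=> h; have z1 := hUVW z; have w1 := hUVW w.
have uz := hU_gt0 z; have uw := hU_gt0 w; have wz := hW_gt0 z; have ww := hW_gt0 w.
have e1 : 2 * hU z * hU w * chd z w = hU z ^+ 2 + hU w ^+ 2 +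
    (hU z * hV w - hV z * hU w) ^+ 2.
  have z2 : hV z ^+ 2 = hU z * hW z - 1 by rewrite -z1 subKr.
  have w2 : hV w ^+ 2 = hU w * hW w - 1 by rewrite -w1 subKr.
  by rewrite /chd; field: z2 w2.
have e2 : 2 * hW z * hW w * chd z w = hW z ^+ 2 + hW w ^+ 2 +
    (hW z * hV w - hV z * hW w) ^+ 2.
  have z2 : hV z ^+ 2 = hU z * hW z - 1 by rewrite -z1 subKr.
  have w2 : hV w ^+ 2 = hU w * hW w - 1 by rewrite -w1 subKr.
  by rewrite /chd; field: z2 w2.
split.
  rewrite -(ler_pM2r uw) -expr2.
  have : 2 * hU z * hU w * chd z w <= 2 * hU z * hU w * C.
    by apply: ler_wpM2l => //; nra.
  rewrite e1; have := sqr_ge0 (hU z * hV w - hV z * hU w); have := sqr_ge0 (hU z); lra.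
rewrite -(ler_pM2r ww) -expr2.
have : 2 * hW z * hW w * chd z w <= 2 * hW z * hW w * C.
  by apply: ler_wpM2l => //; nra.
rewrite e2; have := sqr_ge0 (hW z * hV w - hV z * hW w); have := sqr_ge0 (hW z); lra.
Qed.

(** Each row of the matrix enters [hU (f z)] or [hW (f z)] through a positive definite quadratic
    form of determinant 1, so a bound on the values bounds the entries. *)
Lemma moebius_bound a b c d f p z C : moebius a b c d f -> chd p (f z) <= C ->
  let B := 1 + 2 * C * (hU p + hW p) * (hU z + hW z) in
  [/\ `|a| <= B, `|b| <= B, `|c| <= B & `|d| <= B].
Proof.
move=> hf h B; have [eU _ eW] := hf z; have [bU bW] := chd_bound h.
have z1 := hUVW z; have uz := hU_gt0 z; have wz := hW_gt0 z.
have up := hU_gt0 p; have wp := hW_gt0 p.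
have C0 : 0 < C by have := chd_ge1 p (f z); lra.
have P (x : R) : x ^+ 2 <= B - 1 -> `|x| <= B.
  by move=> hx; rewrite ler_norml; apply/andP; split; nra.
pose K := 2 * C * (hU p + hW p).
have CW : 0 < C * hW p by exact: mulr_gt0.
have CU : 0 < C * hU p by exact: mulr_gt0.
have K0 : 0 <= K by rewrite /K; lra.
have uK : hU (f z) <= K.
  by apply: le_trans bU _; rewrite /K; lra.
have wK : hW (f z) <= K.
  by apply: le_trans bW _; rewrite /K; lra.
have KU : hU z * K <= B - 1 by rewrite /B -/K; nra.
have KW : hW z * K <= B - 1 by rewrite /B -/K; nra.
have z2 : hV z ^+ 2 = hU z * hW z - 1 by rewrite -z1 subKr.
have Q (x y t : R) : t = x ^+ 2 * hW z + 2 * x * y * hV z + y ^+ 2 * hU z -> t <= K ->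
    `|x| <= B /\ `|y| <= B.
  move=> tE tK; split; apply: P.
    have e : hU z * t = (y * hU z + x * hV z) ^+ 2 + x ^+ 2 by rewrite tE; ring: z2.
    have : hU z * t <= hU z * K by rewrite ler_wpM2l // ltW.
    have := sqr_ge0 (y * hU z + x * hV z); lra.
  have e : hW z * t = (x * hW z + y * hV z) ^+ 2 + y ^+ 2 by rewrite tE; ring: z2.
  have : hW z * t <= hW z * K by rewrite ler_wpM2l // ltW.
  have := sqr_ge0 (x * hW z + y * hV z); lra.
by have [? ?] := Q c d _ eU uK; have [? ?] := Q a b _ eW wK.
Qed.

Lemma SL2_den_neq0 (M : 'M[R]_2) z : \det M = 1 ->
  (M 1 0)%:C * val z + (M 1 1)%:C != 0.
Proof.
rewrite det_mx2 => dM; apply/eqP => /eqP; rewrite eq_complex => /andP[/eqP + /eqP].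
have := hIm_gt0 z; rewrite /hIm; case: (val z) => x y /= y0.
move=> e1 e2; have /eqP : M 1 0 * y = 0 by lra.
rewrite mulf_eq0 (gt_eqF y0) orbF => /eqP c0.
have d0 : M 1 1 = 0 by move: e1; rewrite c0; lra.
by move: dM; rewrite c0 d0 !mulr0 subrr => /esym /eqP; rewrite oner_eq0.
Qed.

Lemma acts_as_comp (M N : 'M[R]_2) f g : \det M = 1 -> \det N = 1 ->
  acts_as M f -> acts_as N g -> acts_as (M *m N) (f \o g).
Proof.
move=> dM dN hf hg z; have := SL2_den_neq0 (g z) dM; rewrite hg.
have := SL2_den_neq0 z dN.
rewrite /= hf hg !mxE !big_ord_recl !big_ord0 /= !addr0 !rmorphD !rmorphM /=.
have -> : lift 0 0 = 1 :> 'I_2 by apply: val_inj.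
move: (val z) (M 0 0)%:C (M 0 1)%:C (M 1 0)%:C (M 1 1)%:C (N 0 0)%:C (N 0 1)%:C
  (N 1 0)%:C (N 1 1)%:C => x a b c d a' b' c' d' n1 n2; field.
rewrite n1 andbT; have := mulf_neq0 n2 n1.
rewrite mulrDl -mulrA divfK //.
by apply: contra => /eqP e; apply/eqP; rewrite -e; ring.
Qed.

Definition adj2 (M : 'M[R]_2) : 'M[R]_2 := \matrix_(i, j)
  if i == 0 then (if j == 0 then M 1 1 else - M 0 1)
  else (if j == 0 then - M 1 0 else M 0 0).

Lemma adj2_mul (M : 'M[R]_2) : \det M = 1 -> M *m adj2 M = 1%:M.
Proof.
rewrite det_mx2 => dM; apply/matrixP => i j.
rewrite !mxE !big_ord_recl !big_ord0 /= !mxE /= addr0.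
have -> : lift 0 0 = 1 :> 'I_2 by apply: val_inj.
have : (i == 0) || (i == 1) by case: i => -[|[|]].
have : (j == 0) || (j == 1) by case: j => -[|[|]].
by move=> /orP[] /eqP -> /orP[] /eqP -> /=; rewrite -?dM ?mulr1n ?mulr0n; ring.
Qed.

Lemma acts_as_inv (M : 'M[R]_2) f g : \det M = 1 -> acts_as M f ->
  cancel g f -> acts_as (adj2 M) g.
Proof.
move=> dM hf gK w; rewrite !mxE /= -{2 3}(gK w) hf.
have := SL2_den_neq0 (g w) dM; have : (M 0 0 * M 1 1 - M 0 1 * M 1 0)%:C = 1.
  by rewrite -det_mx2 dM.
rewrite rmorphB !rmorphM !rmorphN /=.
move: (val (g w)) (M 0 0)%:C (M 0 1)%:C (M 1 0)%:C (M 1 1)%:C => x a b c d e n.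
have -> : d * ((a * x + b) / (c * x + d)) + - b = x / (c * x + d).
  transitivity ((a * d - b * c) * x / (c * x + d)); last by rewrite e mul1r.
  by field.
have -> : - c * ((a * x + b) / (c * x + d)) + a = 1 / (c * x + d).
  transitivity ((a * d - b * c) / (c * x + d)); last by rewrite e.
  by field.
by field.
Qed.

Lemma acts_as_id : acts_as (1%:M : 'M[R]_2) id.
Proof.
move=> z; rewrite !mxE /= !mulr1n !mulr0n !rmorph1 !rmorph0.
by rewrite mul1r mul0r addr0 add0r divr1.
Qed.

Lemma discrete_SL2_isolated (A : set 'M[R]_2) : discrete_set A -> A 1%:M ->
  exists2 e : R, 0 < e &
    forall M, A M -> (forall i j, `|M i j - (1%:M : 'M[R]_2) i j| < e) -> M = 1%:M.
Proof.
move=> /[apply] -[_ [V /nbhs_ballP[e /= e0 eV] VA]].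
exists e => // M AM hM.
suff : (V `&` A) M by rewrite VA.
by split=> //; apply: eV; split=> // i j; rewrite /ball /= distrC; apply: hM.
Qed.

Lemma fuchsian_orbit_finite (Gamma : set (H -> H)) p z C : fuchsian Gamma ->
  finite_set [set g | Gamma g /\ chd p (g z) <= C].
Proof.
move=> [[G1 GM GV] GP /discrete_SL2_isolated].
case; first by split; [rewrite /SL2 /= det1 | exists id => //; exact: acts_as_id].
move=> e e0 he.
set S := [set g | _].
have /choice[m hm] : forall g, exists M : 'M[R]_2, Gamma g -> \det M = 1 /\ acts_as M g.
  move=> g; have [/GP[M ? ?]|?] := pselect (Gamma g); last by exists 0.
  by exists M.
pose B := 1 + 2 * C * (hU p + hW p) * (hU z + hW z).
have [C0|C0] := ltP C 0.
  have -> : S = set0; last by [].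
  by apply/seteqP; split=> // g [_]; have := chd_ge1 p (g z); lra.
have B1 : 1 <= B.
  rewrite /B lerDl; have := hU_gt0 p; have := hW_gt0 p; have := hU_gt0 z; have := hW_gt0 z.
  move=> h1 h2 h3 h4; apply: mulr_ge0; last by lra.
  by apply: mulr_ge0; lra.
(* An entry of adj(m g) (m h - m g) is a sum of two products, each at most [B * d]; this mesh keeps
   the sum below [e]. *)
pose d := e / (2 * B + 1).
have d0 : 0 < d by rewrite divr_gt0 //; lra.
have Bd : 2 * B * d < e.
  by rewrite /d mulrCA gtr_pMr // ltr_pdivrMr; lra.
pose N := Num.bound (B / d).
have NB : B / d < N%:R by apply: archi_boundP; rewrite divr_ge0 //; lra.
have mB g : S g -> forall i j, `|m g i j| <= B.
  move=> [Gg /(moebius_bound _) h] i j; have [h1 h2] := hm _ Gg.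
  have [ba bb bc bd] := h _ _ _ _ (acts_as_moebius h1 h2).
  have : (i == 0) || (i == 1) by case: i => -[|[|]].
  have : (j == 0) || (j == 1) by case: j => -[|[|]].
  by move=> /orP[] /eqP -> /orP[] /eqP ->.
(* Pigeonhole: matrices g, h whose entries fall in the same cells of a grid of
   mesh d have g^-1 h close to 1, hence g = h. *)
pose q g i j := inord (Num.truncn (m g i j / d + N%:R)) : 'I_(2 * N).+1.
have qE g i j : S g -> (q g i j)%:R <= m g i j / d + N%:R < (q g i j)%:R + 1.
  move=> Sg; have := mB _ Sg i j; rewrite ler_norml => /andP[b1 b2].
  have h1 : - N%:R <= m g i j / d.
    by rewrite ler_pdivlMr // mulNr lerNl; move: NB; rewrite ltr_pdivrMr //; lra.
  have h2 : m g i j / d <= N%:R.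
    by rewrite ler_pdivrMr //; move: NB; rewrite ltr_pdivrMr //; lra.
  have h0 : 0 <= m g i j / d + N%:R by lra.
  have /andP[t1 t2] := Num.Theory.truncn_itv h0.
  have t3 : (Num.truncn (m g i j / d + N%:R) < (2 * N).+1)%N.
    rewrite ltnS -(ler_nat R) natrM; apply: le_trans t1 _; lra.
  by rewrite /q inordK // t1 -natr1 in t2 *.
(* The value [None] marks the maps outside [S], so that [S] is the preimage of a finite set under a
   map injective on it. *)
pose F g := if pselect (S g) then Some [ffun ij : 'I_2 * 'I_2 => q g ij.1 ij.2] else None.
have -> : S = F @^-1` [set~ None].
  by apply/seteqP; split=> g /=; rewrite /F; case: pselect.
apply: finite_preimage; last exact: finite_finset.
move=> g h; rewrite !inE /= /F; case: pselect => // Sg _; case: pselect => // Sh _.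
move=> [/ffunP Fgh].
have [Gg _] := Sg; have [Gh _] := Sh.
have close i j : `|m h i j - m g i j| < d.
  have := Fgh (i, j); rewrite !ffunE /= => qgh.
  have := qE _ i j Sg; have := qE _ i j Sh; rewrite qgh => /andP[h1 h2] /andP[h3 h4].
  have : `|m h i j / d - m g i j / d| < 1 by rewrite ltr_norml; apply/andP; split; lra.
  by rewrite -mulrBl normrM (gtr0_norm (x := d^-1)) ?invr_gt0 // ltr_pdivrMr // mul1r.
have [dg ag] := hm _ Gg; have [dh ah] := hm _ Gh.
have [g' Gg' [gK g'K]] := GV _ Gg.
have dadj : \det (adj2 (m g)) = 1.
  by have := congr1 (fun M => \det M) (adj2_mul dg); rewrite det_mulmx dg mul1r det1.
have adjl : adj2 (m g) *m m g = 1%:M by apply: mulmx1C; exact: adj2_mul.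
have key : adj2 (m g) *m m h = 1%:M.
  apply: he.
    split; first by rewrite /SL2 /= det_mulmx dadj dh mulr1.
    exists (g' \o h); first exact: GM.
    by apply: acts_as_comp => //; exact: acts_as_inv ag g'K.
  move=> i j; rewrite -adjl.
  have -> : (adj2 (m g) *m m h) i j - (adj2 (m g) *m m g) i j =
      (adj2 (m g) *m (m h - m g)) i j by rewrite mulmxBr !mxE.
  rewrite mxE !big_ord_recl big_ord0 addr0; apply: le_lt_trans Bd.
  have adjB k l : `|adj2 (m g) k l| <= B.
    by rewrite mxE; do 2! case: ifP => _; rewrite ?normrN; exact: mB.
  have P k : `|adj2 (m g) i k * (m h - m g) k j| <= B * d.
    rewrite normrM ler_pM // !mxE; exact/ltW/close.
  apply: le_trans (ler_normD _ _) _; have := P 0; have := P (lift 0 0); lra.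
have mgh : m g = m h.
  by rewrite -[m g]mulmx1 -key mulmxA adj2_mul // mul1mx.
apply/funext => x; apply: val_inj; rewrite ag ah mgh //.
Qed.

End Discreteness.

(** * Polygons and Dirichlet domains *)

Section Polygons.
Variable R : realType.
Local Notation H := (UHP R).
Implicit Types (z w m q : H) (f g : H -> H) (L : geodesic R) (P : set H).
Implicit Types (h : geodesic R * bool).

(** No measurability is assumed, so the comparison is made between the suprema over simple functions
    that define the integrals. *)
Lemma harea_mono (A B : set H) : A `<=` B -> (harea A <= harea B)%E.
Proof.
move=> AB; have AB' : @to_plane R @` A `<=` @to_plane R @` B by exact: image_subset.
have f0 (p : R * R) : (0 <= ((p.2 ^+ 2)^-1)%:E)%E by rewrite lee_fin invr_ge0 sqr_ge0.
rewrite /harea !ge0_integralE; do 2? by move=> *; exact: f0.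
apply: ereal_sup_le => _ [h /= hA <-]; exists h => //= p.
apply: le_trans (hA p) _; rewrite /patch.
case: ifPn => [|_]; last by case: ifP.
by rewrite inE => /AB' /mem_set ->.
Qed.

Definition hfun (h : geodesic R * bool) z := sgn h.2 (gphi h.1 z).

Lemma hfunE h z : hfun h z =
  lin (sgn h.2 (- gB h.1)) (sgn h.2 (- (2 * gA h.1))) (sgn h.2 (gC h.1)) z.
Proof. by case: h => L [] //=; rewrite /hfun /gphi /lin /=; ring. Qed.

Lemma hfun_neq0 h :
  (sgn h.2 (- gB h.1), sgn h.2 (- (2 * gA h.1)), sgn h.2 (gC h.1)) != (0, 0, 0).
Proof.
case: h => L [] /=; first exact: gphi_neq0.
apply: contra (gphi_neq0 L) => /eqP -[/eqP + /eqP + /eqP].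
by rewrite !oppr_eq0 => /eqP -> /eqP -> /eqP ->; rewrite !oppr0.
Qed.

Lemma hfun0 h z : (hfun h z = 0) <-> (gphi h.1 z = 0).
Proof.
by case: h => L []; rewrite /hfun //=; split=> /eqP; rewrite ?oppr_eq0 => /eqP // ->; rewrite oppr0.
Qed.

Lemma interior_hfun_gt0 P h q : P° q -> (forall z, P z -> 0 <= hfun h z) -> 0 < hfun h q.
Proof.
move=> Pq Ph; rewrite hfunE; apply: interior_lin_gt0 Pq _ (hfun_neq0 h).
by move=> w /Ph; rewrite hfunE.
Qed.

Lemma hfun_near h z : 0 < hfun h z -> \forall w \near z, 0 < hfun h w.
Proof.
by rewrite hfunE => /lin_near; apply: filterS => w; rewrite hfunE.
Qed.

Lemma interior_off_line P q L : P° q -> exists2 w, P° w & gphi L w <> 0.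
Proof.
move=> Pq; apply: contrapT => h.
have L0 w : P° w -> gphi L w = 0.
  by move=> Pw; apply: contrapT => n; apply: h; exists w.
have : 0 < gphi L q.
  apply: (interior_lin_gt0 (A := P°)) (gphi_neq0 L); first exact: nbhs_interior.
  by move=> w /L0; rewrite /gphi => ->.
by rewrite L0 ?ltxx.
Qed.

Lemma segment_mid z w : exists m, forall p q r : R,
  exists2 k, 0 < k & lin p q r m = k * (lin p q r z + lin p q r w).
Proof.
have [m [k k0 mE]] := @segment_ex R z w 1 1 ler01 ler01 (addr_gt0 ltr01 ltr01).
by exists m => p q r; exists k; rewrite // mE !mul1r.
Qed.

Lemma lin_mid_eq0 (p q r : R) z w (k x : R) : 0 < k -> x = k * (lin p q r z + lin p q r w) ->
  0 <= lin p q r z -> 0 <= lin p q r w -> x = 0 -> lin p q r z = 0 /\ lin p q r w = 0.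
Proof.
move=> k0 -> hz hw /eqP; rewrite mulf_eq0 (gt_eqF k0) /= paddr_eq0 //.
by move=> /andP[/eqP -> /eqP ->].
Qed.

(** The point [x] violates only the condition [i], so every segment from [x] to an interior point of
    [P] crosses the line of [h i] inside [P]. Two interior points not aligned with [x] give two
    distinct crossings. *)
Lemma irredundant_side n (h : 'I_n.+1 -> geodesic R * bool) P i x q :
  (forall z, P z <-> forall j, 0 <= hfun (h j) z) ->
  P° q -> hfun (h i) x < 0 -> (forall j, 0 <= hfun (h (lift i j)) x) ->
  side_of P (h i).1.
Proof.
move=> PE Pq xi xj.
have Pge j z : P z -> 0 <= hfun (h j) z by move=> /PE.
split; first by exists (h i).2 => z /(Pge i) ?; apply/half_planeE.
have xPl w : P° w -> exists m, [/\ P m, gphi (h i).1 m = 0 &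
    exists2 k, k != 0 & forall L, gphi L x = 0 -> gphi L m = k * gphi L w].
  move=> Pw; have wi := interior_hfun_gt0 Pw (Pge i).
  (* These weights make the form of [h i] cancel at [m]. *)
  have [m [k k0 mE]] := @segment_ex R x w (hfun (h i) w) (- hfun (h i) x)
    (ltW wi) ltac:(by rewrite oppr_ge0 ltW) ltac:(by rewrite addr_gt0 // oppr_gt0).
  have mi : hfun (h i) m = 0 by rewrite hfunE mE -!hfunE; ring.
  exists m; split.
  - apply/PE => j; case: (unliftP i j) => [j' ->|->]; last by rewrite mi.
    rewrite hfunE mE -!hfunE; apply: mulr_ge0; first exact: ltW.
    apply: addr_ge0; first by apply: mulr_ge0; [exact: ltW | exact: xj].
    apply: mulr_ge0; first by rewrite oppr_ge0 ltW.
    by apply: Pge; exact: interior_subset Pw.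
  - by apply/hfun0.
  - exists (k * - hfun (h i) x); first by rewrite mulf_neq0 ?oppr_eq0 // ?(gt_eqF k0) ?(lt_eqF xi).
    by move=> L Lx; rewrite /gphi mE -/(gphi L x) Lx -/(gphi L w); ring.
have [m [Pm mi [k k0 mk]]] := xPl _ Pq.
have [L [Lx Lq]] := geodesic_ex x q.
have [w Pw Lw] := interior_off_line L Pq.
have [m' [Pm' mi' [k' k0' mk']]] := xPl _ Pw.
exists m, m'; split; last first.
- by split=> //; apply/gphi0.
- by split=> //; apply/gphi0.
apply/eqP => mm; apply: Lw; have := mk' _ Lx; rewrite -mm (mk _ Lx) Lq mulr0.
by move=> /esym /eqP; rewrite mulf_eq0 (negbTE k0') => /eqP.
Qed.

(** Redundant half-planes are dropped one at a time, until each that is left carries a side;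
    crossing a violated half-plane is then always reflection in a side. *)
Lemma polygon_sides P : polygon P -> exists n (h : 'I_n -> geodesic R * bool),
  (forall z, P z <-> forall j, 0 <= hfun (h j) z) /\ (forall j, side_of P (h j).1).
Proof.
move=> [[n [h PE]] [q Pq] _].
have {}PE : forall z, P z <-> forall j, 0 <= hfun (h j) z.
  move=> z; rewrite PE; split=> [Ph j|Ph j _]; first by have /half_planeE := Ph j Logic.I.
  by apply/half_planeE; exact: Ph.
elim: n h PE => [|n IH] h PE; first by exists 0%N, h; split=> // -[].
have [[i hi]|nex] := pselect (exists i, forall z,
    (forall j, 0 <= hfun (h (lift i j)) z) -> 0 <= hfun (h i) z).
  apply: (IH (fun j => h (lift i j))) => z; split=> [/PE|hz]; first by move=> + j.
  apply/PE => j; case: (unliftP i j) => [j' ->|->]; [exact: hz | exact: hi].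
exists n.+1, h; split=> // i.
have [x /not_implyP[xj /negP]] : exists x, ~ ((forall j, 0 <= hfun (h (lift i j)) x) ->
    0 <= hfun (h i) x).
  by apply: contrapT => hx; apply: nex; exists i => x; apply: contrapT => hx'; apply: hx; exists x.
by rewrite -ltNge => xi; exact: (irredundant_side PE Pq xi xj).
Qed.

Lemma near_seq (T : eqType) (s : seq T) (A : T -> set H) m :
  (forall t, t \in s -> \forall z \near m, A t z) ->
  \forall z \near m, forall t, t \in s -> A t z.
Proof.
elim: s => [|a s IH] h; first by apply: filterE => z t.
have h1 := h a (mem_head _ _).
have h2 := IH (fun t ts => h t (mem_behead (s := a :: s) ts)).
apply: filterS (filterI h1 h2) => z [za zs] t; rewrite in_cons => /orP[/eqP ->//|].
exact: zs.
Qed.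

(** A Harnack-type estimate, uniform in [w], that controls the far part of an orbit near [m]. The
    constant 9 is a crude bound for points whose coordinates differ from those of [m] by less than
    [hIm m / 2]. *)
Lemma chd_near m : \forall z \near m, forall w, chd m w <= 9 * chd z w /\ chd z w <= 9 * chd m w.
Proof.
have y0 := hIm_gt0 m; have y2 : 0 < hIm m / 2 by rewrite divr_gt0.
have n1 : \forall z \near m, `|hRe m - hRe z| < hIm m / 2.
  by move: y2; refine (@cvgr_dist_lt _ _ _ _ _ _ _ (@hRe_continuous R m) _).
have n2 : \forall z \near m, `|hIm m - hIm z| < hIm m / 2.
  by move: y2; refine (@cvgr_dist_lt _ _ _ _ _ _ _ (@hIm_continuous R m) _).
apply: filterS (filterI n1 n2) => z [].
rewrite /= !ltr_norml => /andP[a1 a2] /andP[b1 b2] w.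
have yz := hIm_gt0 z; have yw := hIm_gt0 w.
have e1 : chd m w * (2 * hIm m * hIm w) = (hRe m - hRe w) ^+ 2 + hIm m ^+ 2 + hIm w ^+ 2.
  by rewrite chdE divfK // !mulf_neq0 // ?hIm_neq0.
have e2 : chd z w * (2 * hIm z * hIm w) = (hRe z - hRe w) ^+ 2 + hIm z ^+ 2 + hIm w ^+ 2.
  by rewrite chdE divfK // !mulf_neq0 // ?hIm_neq0.
have c1 := chd_ge1 m w; have c2 := chd_ge1 z w.
have d1 : (hRe m - hRe z) ^+ 2 <= hIm m ^+ 2 / 4 by nra.
have s1 : (hRe m - hRe w) ^+ 2 <= 2 * (hRe z - hRe w) ^+ 2 + 2 * (hRe m - hRe z) ^+ 2.
  by have := sqr_ge0 ((hRe m - hRe z) - (hRe z - hRe w)); nra.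
have s2 : (hRe z - hRe w) ^+ 2 <= 2 * (hRe m - hRe w) ^+ 2 + 2 * (hRe m - hRe z) ^+ 2.
  by have := sqr_ge0 ((hRe m - hRe z) + (hRe m - hRe w)); nra.
have t1 : hIm m ^+ 2 <= 4 * hIm z ^+ 2 by nra.
have t2 : 4 * hIm z ^+ 2 <= 9 * hIm m ^+ 2 by nra.
have w2 := sqr_ge0 (hIm w); have r1 := sqr_ge0 (hRe m - hRe w); have r2 := sqr_ge0 (hRe z - hRe w).
have z2 := sqr_ge0 (hIm z); have m2 := sqr_ge0 (hIm m).
have v1 : hIm w * hIm z <= 3 / 2 * (hIm w * hIm m).
  by rewrite mulrCA ler_pM2l //; lra.
have v2 : hIm w * hIm m <= 2 * (hIm w * hIm z) by rewrite mulrCA ler_pM2l //; lra.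
have W1 : 0 < 2 * hIm m * hIm w by rewrite !mulr_gt0.
have W2 : 0 < 2 * hIm z * hIm w by rewrite !mulr_gt0.
have q1 : chd z w * (hIm w * hIm z) <= chd z w * (3 / 2 * (hIm w * hIm m)).
  by rewrite ler_wpM2l //; lra.
have q2 : chd m w * (hIm w * hIm m) <= chd m w * (2 * (hIm w * hIm z)).
  by rewrite ler_wpM2l //; lra.
split.
  by rewrite -(ler_pM2r W1) e1; lra.
by rewrite -(ler_pM2r W2) e2; lra.
Qed.

End Polygons.

Section Dirichlet.
Variable R : realType.
Local Notation H := (UHP R).
Implicit Types (z w m q : H) (f g : H -> H) (L : geodesic R).
Variables (Gamma : set (H -> H)) (P : set H) (z0 : H).
Hypothesis fuchsG : fuchsian Gamma.
Hypothesis fundP : fundamental_domain Gamma P.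
Hypothesis dirP : P = dirichlet_domain Gamma z0.

Lemma groupG : transformation_group Gamma.
Proof. by case: fuchsG. Qed.

Lemma fuchsian_moebius g : Gamma g ->
  exists a b c d, a * d - b * c = 1 /\ moebius a b c d g.
Proof.
case: fuchsG => _ GP _ /GP[M dM hM].
exists (M 0 0), (M 0 1), (M 1 0), (M 1 1); split; first by rewrite -dM det_mx2.
exact: acts_as_moebius.
Qed.

Lemma fuchsian_chd g z w : Gamma g -> chd (g z) (g w) = chd z w.
Proof.
move=> /fuchsian_moebius[a [b [c [d [e h]]]]]; apply: moebius_chd h.
by rewrite e expr1n.
Qed.

Lemma dirichletP x : P x <-> forall a, Gamma a -> chd x z0 <= chd x (a z0).
Proof.
rewrite dirP; split=> h a Ga; last by move=> _; rewrite ler_hdist; exact: h.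
have [->//|n] := pselect (a = id).
by rewrite -ler_hdist; exact: h.
Qed.

(** Near [m] only finitely many orbit points compete. Those with [chd] from [m] above 81 = 9 * 9
    times [chd m z0] stay farther than [z0], as [chd_near] costs a factor 9 on each side. *)
Lemma dirichlet_interior m :
  (forall a, Gamma a -> a z0 = z0 \/ chd m z0 < chd m (a z0)) -> P° m.
Proof.
move=> hm.
have /finite_seqP[s sE] := fuchsian_orbit_finite m z0 (81 * chd m z0) fuchsG.
have near_s : \forall z \near m, forall a, a \in s -> chd z z0 <= chd z (a z0).
  apply: near_seq => a /= as_.
  have [Ga _] : [set g | Gamma g /\ chd m (g z0) <= 81 * chd m z0] a by rewrite sE.
  have [->|lt] := hm _ Ga; first by apply: filterE.
  have : 0 < bis z0 (a z0) m by rewrite bisE mulr_gt0 // subr_gt0.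
  move=> /lin_near; apply: filterS => z; rewrite -/(bis z0 (a z0) z) bisE.
  by rewrite pmulr_rgt0 // subr_gt0 => /ltW.
apply: filterS (filterI near_s (chd_near m)) => z [zs zm].
apply/dirichletP => a Ga.
have [le|gt] := leP (chd m (a z0)) (81 * chd m z0).
  by apply: zs; have : [set` s] a by rewrite -sE.
have [k1 _] := zm (a z0); have [_ k2] := zm z0; lra.
Qed.

Lemma center_interior : P° z0.
Proof.
apply: dirichlet_interior => a Ga; rewrite chdzz.
have [le|] := leP (chd z0 (a z0)) 1; last by right.
by left; rewrite -(chd_le1 le).
Qed.

(** An element fixing [z0] imposes no condition on the Dirichlet domain; it is excluded because [z0]
    would be a common point of the interior and its translate. *)
Lemma center_free a : Gamma a -> a z0 = z0 -> a = id.
Proof.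
move=> Ga az; apply: contrapT => an; case: fundP => _ _ /(_ a Ga an) h.
have : (P° `&` a @` P°) z0.
  by split; [exact: center_interior | exists z0 => //; exact: center_interior].
by rewrite h.
Qed.

Definition strict q := forall a, Gamma a -> a <> id -> chd q z0 < chd q (a z0).

Lemma interior_strict q : P° q <-> strict q.
Proof.
split=> [Pq a Ga an|sq]; last first.
  apply: dirichlet_interior => a Ga; have [->|an] := pselect (a = id); first by left.
  by right; exact: sq.
have zn : z0 <> a z0 by move=> /esym /(center_free Ga).
suff : 0 < bis z0 (a z0) q by rewrite bisE pmulr_rgt0 // subr_gt0.
apply: interior_lin_gt0 Pq _ (bis_neq0 zn) => w /dirichletP /(_ a Ga) ?.
by rewrite -/(bis z0 (a z0) w) bisE mulr_ge0 // subr_ge0.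
Qed.

(** Moved back by the inverse [b] of [a], the hypothesis on [a q] says that [q] is no farther from
    [b z0] than from [z0]. *)
Lemma strict_free q a : strict q -> Gamma a -> P (a q) -> a = id.
Proof.
move=> sq Ga /dirichletP /(_ _ Ga); rewrite fuchsian_chd // => le.
apply: contrapT => an; have [_ _ /(_ _ Ga)[b Gb [ab ba]]] := groupG.
have bn : b <> id by move=> bE; apply: an; apply/funext => x; rewrite -[RHS]ba bE.
by have := sq _ Gb bn; rewrite -[X in _ < X](fuchsian_chd _ _ Ga) ba ltNge le.
Qed.

(* The point [m], in both [P] and [a P], makes the same [a] work for any other
   convex description of [P]: a second center or the Ford conditions. *)
Lemma dirichlet_side L : side_of P L ->
  exists a b z w m, [/\ [/\ Gamma a, Gamma b, cancel a b & cancel b a],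
    [/\ z <> w, gphi L z = 0 & gphi L w = 0],
    [/\ a <> id, P m & P (b m)],
    forall f, is_reflection L f -> f z0 = a z0 &
    forall p q r : R, (forall x, P x -> 0 <= lin p q r x) -> lin p q r m = 0 ->
      lin p q r z = 0 /\ lin p q r w = 0].
Proof.
move=> [[s PL] [z [w [/eqP zw [Pz /gphi0 Lz] [Pw /gphi0 Lw]]]]].
have [m mE] := segment_mid z w.
have Pm : P m.
  apply/dirichletP => a Ga; rewrite -subr_ge0 -(pmulr_rge0 _ (ltr0n _ 2)) -bisE /bis.
  have [k k0 ->] := mE (hW (a z0) - hW z0) (- (2 * (hV (a z0) - hV z0))) (hU (a z0) - hU z0).
  rewrite pmulr_rge0 // -!/(bis _ _ _) !bisE addr_ge0 // mulr_ge0 // subr_ge0.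
    by move/dirichletP: Pz; exact.
  by move/dirichletP: Pw; exact.
have Lm : gphi L m = 0.
  by have [k k0] := mE (- gB L) (- (2 * gA L)) (gC L); rewrite -!/(gphi L _) Lz Lw addr0 mulr0.
have trans (p q r : R) : (forall x, P x -> 0 <= lin p q r x) -> lin p q r m = 0 ->
      lin p q r z = 0 /\ lin p q r w = 0.
  move=> Pge; have [k k0 e] := mE p q r.
  by apply: (lin_mid_eq0 k0 e); exact: Pge.
(* Otherwise [m] would be an interior point of [P], yet it lies on the line [L] bounding [P]. *)
have [a [Ga an am]] : exists a, [/\ Gamma a, a <> id & chd m (a z0) <= chd m z0].
  apply: contrapT => nex.
  have Pim : P° m.
    apply/interior_strict => a Ga an; rewrite ltNge; apply/negP => le.
    by apply: nex; exists a.
  have := @interior_hfun_gt0 R P (L, s) m Pim.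
  rewrite (_ : hfun (L, s) m = 0); last exact/hfun0.
  by rewrite ltxx => h; suff : false by []; apply: h => x /PL /half_planeE.
have zn : z0 <> a z0 by move=> /esym /(center_free Ga).
have am' : chd m (a z0) = chd m z0.
  by apply/eqP; rewrite eq_le am /=; move/dirichletP: Pm; exact.
have [_ _ /(_ _ Ga)[b Gb [ab ba]]] := groupG.
exists a, b, z, w, m; split=> //.
  (* For [P (b m)]: applying [a] turns the distances from [b m] to [z0] and [c z0] into those from
     [m] to [a z0] and [a (c z0)], and the first equals that to [z0]. *)
  split=> //; apply/dirichletP => c Gc.
  rewrite -(fuchsian_chd _ _ Ga) ba -[X in _ <= X](fuchsian_chd _ _ Ga) ba am'.
  move/dirichletP: Pm => /(_ (a \o c)); apply.
  by have [_ GM _] := groupG; exact: GM.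
move=> f fL; have [bz bw] : bis z0 (a z0) z = 0 /\ bis z0 (a z0) w = 0.
  apply: trans => [x /dirichletP /(_ _ Ga) ?|].
    by rewrite -/(bis _ _ _) bisE mulr_ge0 // subr_ge0.
  by rewrite -/(bis _ _ _) bisE am' subrr mulr0.
exact: (bis_reflection fL zn zw Lz Lw bz bw).
Qed.

End Dirichlet.

(** * Orientation-reversing isometries with a fixed point *)

Section OrientationReversing.
Variable R : realType.
Local Notation H := (UHP R).
Implicit Types (z w : H) (f g : H -> H) (L : geodesic R).

(** From M S M^T = S follows det(M) M S = S adj(M^T), which is linear in the entries of M; [k1] and
    [k2] are its first row. *)
Lemma moebius_fix (a b c d : R) f z : a * d - b * c = -1 -> moebius a b c d f ->
  f z = z -> d = - a /\ lin (- b) (- (2 * a)) c z = 0.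
Proof.
move=> e hf fz; have [] := hf z; rewrite fz => eU eV eW.
have w0 := hW_gt0 z; have u0 := hU_gt0 z.
have k1 : (a * hW z + b * hV z) * (a * d - b * c) = hW z * d - hV z * b.
  transitivity ((a ^+ 2 * hW z + 2 * a * b * hV z + b ^+ 2 * hU z) * d -
    (a * c * hW z + (a * d + b * c) * hV z + b * d * hU z) * b); first by ring.
  by rewrite -eW -eV.
have k2 : (a * hV z + b * hU z) * (a * d - b * c) = - hW z * c + hV z * a.
  transitivity (- (a ^+ 2 * hW z + 2 * a * b * hV z + b ^+ 2 * hU z) * c +
    (a * c * hW z + (a * d + b * c) * hV z + b * d * hU z) * a); first by ring.
  by rewrite -eW -eV.
have da : d = - a.
  by apply: (mulIf (lt0r_neq0 w0)); move: k1; rewrite e; lra.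
by split=> //; move: k2; rewrite e /lin; lra.
Qed.

Lemma moebius_reflection (a b c e : R) f g L : moebius a b c (- a) f ->
  is_reflection L g -> e ^+ 2 = 1 -> gA L = e * a -> gB L = e * b -> gC L = e * c -> f = g.
Proof.
move=> hf /is_reflectionP hg e1 eA eB eC; apply: (moebius_eq e1 hf hg) => //.
by rewrite eA mulrN.
Qed.

End OrientationReversing.

(** * The reflection group *)

Section Groups.
Variable R : realType.
Local Notation H := (UHP R).
Implicit Types (f g : H -> H) (S A : set (H -> H)).

Lemma generated_sub S A : transformation_group A -> S `<=` A -> generated S `<=` A.
Proof. by move=> gA SA; apply: smallest_sub. Qed.

Lemma cancel_uniq f g g' : cancel f g -> cancel g' f -> g' = g.
Proof. by move=> fg g'f; apply/funext => x; rewrite -{2}(g'f x) fg. Qed.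

(* Some group must contain S: otherwise [generated S], an empty intersection,
   is the set of all maps. *)
Lemma generated_group S A : transformation_group A -> S `<=` A ->
  transformation_group (generated S).
Proof.
move=> gA SA; split.
- by move=> B [[]].
- by move=> f g Sf Sg B [gB SB]; have [_ M _] := gB; apply: M; [apply: Sf | apply: Sg].
move=> f Sf; have [_ _ /(_ f (generated_sub gA SA Sf))[g Ag [fg gf]]] := gA.
exists g => // B [gB SB]; have [_ _ /(_ f (Sf B (conj gB SB)))[g' Bg' [fg' g'f]]] := gB.
by rewrite (cancel_uniq fg' gf).
Qed.

Lemma generated_in S : S `<=` generated S.
Proof. by move=> f Sf B [_]; apply. Qed.

Lemma side_half_plane P L : side_of (R := R) P L -> exists s, forall z, P z -> 0 <= hfun (L, s) z.
Proof. by case=> -[s PL] _; exists s => z /PL /half_planeE. Qed.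

End Groups.

Section ReflectionGroup.
Variable R : realType.
Local Notation H := (UHP R).
Implicit Types (z w m q x : H) (f g k : H -> H).
Variables (Gamma : set (H -> H)) (P : set H) (z0 : H) (L : geodesic R) (rho : H -> H).
Hypothesis fuchsG : fuchsian Gamma.
Hypothesis fundP : fundamental_domain Gamma P.
Hypothesis dirP : P = dirichlet_domain Gamma z0.
Hypothesis Lz0 : gphi L z0 = 0.
Hypothesis rhoL : is_reflection L rho.
(** This is what the Double Dirichlet and the DF case each have to supply: modulo [Gamma], all side
    reflections agree with the one reflection [rho]. *)
Hypothesis sideP : forall L' f, side_of P L' -> is_reflection L' f ->
  exists2 a, Gamma a & f = a \o rho.

Let Gid : Gamma id. Proof. by have [] := groupG fuchsG. Qed.
Let GM f g : Gamma f -> Gamma g -> Gamma (f \o g).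
Proof. by have [_ h _] := groupG fuchsG; exact: h. Qed.
Let GV f : Gamma f -> exists2 g, Gamma g & cancel f g /\ cancel g f.
Proof. by have [_ _ h] := groupG fuchsG; exact: h. Qed.
Let Gchd g z w : Gamma g -> chd (g z) (g w) = chd z w.
Proof. exact: fuchsian_chd. Qed.
Let inP x : P x <-> forall a, Gamma a -> chd x z0 <= chd x (a z0).
Proof. exact: dirichletP. Qed.
Let rhoK : cancel rho rho := reflK rhoL.
Let rho0 : rho z0 = z0 := refl_fix rhoL Lz0.
Let rchd z w : chd (rho z) (rho w) = chd z w := refl_chd rhoL z w.
Let Pz0 : P° z0 := center_interior fuchsG dirP.
Let cfree := center_free fuchsG fundP dirP.
Let polyP : polygon P. Proof. by case: fundP. Qed.

(* The maps t = k g, with k and rho k rho in Gamma, include one minimizing the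
   distance from t z0 to z0; as crossing a side of P is such a step, the
   minimizer takes z0 into P, so it is the identity. *)
Lemma conj_rho g : Gamma g -> Gamma (rho \o g \o rho).
Proof.
move=> Gg.
pose B : set (H -> H) := [set t | exists k, [/\ Gamma k, Gamma (rho \o k \o rho) & t = k \o g]].
have Bg : B g.
  exists id; split=> //; rewrite (_ : rho \o id \o rho = id) //.
  by apply/funext => x; exact: rhoK.
have BG t : B t -> Gamma t by move=> [k [Gk _ ->]]; exact: GM.
have [|t Bt tmin] := @exists_min R _ B (fun t => chd z0 (t z0)) g Bg.
  apply: sub_finite_set (fuchsian_orbit_finite z0 z0 (chd z0 (g z0)) fuchsG).
  by move=> t [/BG Gt le].
have [n [h [PE hs]]] := polygon_sides polyP.
have Pt : P (t z0).
  apply/PE => j; rewrite leNgt; apply/negP => lt.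
  have [f fh] := reflection_ex (h j).1.
  have [a Ga fa] := sideP (hs j) fh.
  have fK := reflK fh.
  (* Since [f], equal to [a \o rho], is an involution, [rho \o f] is the inverse of [a]. *)
  have rf x : rho (f (a x)) = x.
    by apply: (can_inj rhoK); apply: (can_inj fK); rewrite rhoK fK fa /= rhoK.
  have ar x : a (rho (f x)) = x by have := fK x; rewrite {1}fa.
  have [b Gb [ab ba]] := GV Ga.
  have bE : rho \o f = b.
    by apply/funext => x; rewrite -[b x](rf (b x)) ba.
  have Brf : B (rho \o f \o t).
    have [k [Gk Gk' ->]] := Bt; exists (rho \o f \o k); split=> //.
      by rewrite bE; exact: GM.
    have -> : rho \o (rho \o f \o k) \o rho = a \o (rho \o k \o rho).
      by apply/funext => x; rewrite /= rhoK fa.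
    exact: GM.
  (* As [rho] fixes [z0], only the effect of [f] counts: it brings [t z0] closer to [z0], which lies
     on the other side of its axis. *)
  have := tmin _ Brf; rewrite /= -[X in _ <= chd X _]rho0 rchd !(chdC z0) (refl_chd_sub fh).
  have z0j := interior_hfun_gt0 Pz0 (fun z Pz => (PE z).1 Pz j).
  move: lt z0j; rewrite /hfun; case: (h j).2 => /= l1 l2; nra.
have tz : t z0 = z0.
  by apply: chd_le1; rewrite -(chdzz (t z0)); move/inP: Pt; apply; exact: BG.
have tid := cfree (BG _ Bt) tz.
(* Now [k \o g] is the identity, so [rho \o g \o rho] is the inverse of [rho \o k \o rho]. *)
have [k [Gk Gk' tk]] := Bt.
have [u Gu [uk ku]] := GV Gk'.
have -> : rho \o g \o rho = u; last by [].
apply/funext => x; rewrite -[LHS]uk /= rhoK -[k (g _)]/((k \o g) _) -tk tid.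
by rewrite rhoK.
Qed.

Definition extended : set (H -> H) :=
  [set g | Gamma g \/ exists2 k, Gamma k & g = k \o rho].

Lemma extended_group : transformation_group extended.
Proof.
have cr k : rho \o (rho \o k \o rho) = k \o rho by apply/funext => x; rewrite /= rhoK.
split; first by left.
  move=> f g [Gf|[k Gk ->]] [Gg|[k' Gk' ->]].
  - by left; exact: GM.
  - by right; exists (f \o k') => //; exact: GM.
  - right; exists (k \o (rho \o g \o rho)); first by apply: GM => //; exact: conj_rho.
    by apply/funext => x; rewrite /= rhoK.
  - by left; apply: (GM Gk (conj_rho Gk')).
move=> f [Gf|[k Gk ->]].
  by have [g Gg ?] := GV Gf; exists g => //; left.
have [g Gg [kg gk]] := GV Gk.
exists (rho \o g).
  right; exists (rho \o g \o rho); first exact: conj_rho.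
  by apply/funext => x; rewrite /= rhoK.
by split=> x /=; rewrite ?kg ?rhoK ?gk.
Qed.

Lemma extended_chd g z w : extended g -> chd (g z) (g w) = chd z w.
Proof. by move=> [Gg|[k Gk ->]] /=; rewrite Gchd // rchd. Qed.

Lemma extended_orbit_finite p z C :
  finite_set [set g | extended g /\ chd p (g z) <= C].
Proof.
have h1 := fuchsian_orbit_finite p z C fuchsG.
have h2 := finite_image (fun k => k \o rho) (fuchsian_orbit_finite p (rho z) C fuchsG).
apply: sub_finite_set (_ : finite_set (_ `|` _)); last first.
  by rewrite finite_setU; split; [exact: h1 | exact: h2].
by move=> g [[Gg|[k Gk ->]] le]; [left | right; exists k].
Qed.

Lemma rho_mem x : P x -> P (rho x).
Proof.
move=> /inP Px; apply/inP => a Ga; have := Px _ (conj_rho Ga).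
by rewrite -[chd x z0]rchd rho0 -[chd x ((rho \o a \o rho) z0)]rchd /= rhoK rho0.
Qed.

Lemma strict_rho q : strict Gamma z0 q -> strict Gamma z0 (rho q).
Proof.
move=> sq a Ga an; have /(sq _ (conj_rho Ga)) : rho \o a \o rho <> id.
  move=> e; apply: an; apply/funext => x.
  by apply: (can_inj rhoK); have := congr1 (@^~ (rho x)) e; rewrite /= rhoK.
by rewrite -[chd q z0]rchd rho0 -[chd q ((rho \o a \o rho) z0)]rchd /= rhoK rho0.
Qed.

(* The polygon Q of the theorem. *)
Definition half_domain : set H := P `&` half_plane L true.
Local Notation Q := half_domain.

Lemma half_domainP x : Q x <-> P x /\ 0 <= gphi L x.
Proof. by split=> -[Px Lx]; split=> //; apply/(half_planeE L true). Qed.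

Lemma half_interior q : Q° q <-> strict Gamma z0 q /\ 0 < gphi L q.
Proof.
split=> [Qq|[sq Lq]].
  split.
    apply/(interior_strict fuchsG fundP dirP); apply: interiorS Qq => x.
    by move=> /half_domainP[].
  apply: interior_lin_gt0 Qq _ (gphi_neq0 L) => w /half_domainP[_].
  by rewrite /gphi.
have /(interior_strict fuchsG fundP dirP) Pq := sq.
apply: filterS (filterI Pq (lin_near Lq)) => x [Px Lx].
by apply/half_domainP; split=> //; exact: ltW.
Qed.

(** For [k \o rho], the point [rho q] is strict as well, which forces [k] to be the identity; but
    [rho q] lies on the wrong side of [L]. *)
Lemma half_free q g : Q° q -> extended g -> Q (g q) -> g = id.
Proof.
move=> /half_interior[sq Lq] [Gg|[k Gk ->]] /half_domainP[Pg Lg].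
  exact: (strict_free fuchsG dirP sq Gg Pg).
have kid := strict_free fuchsG dirP (strict_rho sq) Gk Pg.
by move: Lg; rewrite kid /= (refl_phi rhoL) oppr_ge0 leNgt Lq.
Qed.

Lemma half_interior_ex : exists q, Q° q.
Proof.
have [q /(interior_strict fuchsG fundP dirP) sq Lq] := interior_off_line L Pz0.
have [l|l|//] := ltgtP (gphi L q) 0.
  exists (rho q); apply/half_interior; split; first exact: strict_rho.
  by rewrite (refl_phi rhoL) oppr_gt0.
by exists q; apply/half_interior.
Qed.

Lemma half_polygon : polygon Q.
Proof.
have [[n [h PE]] _ aP] := polyP.
split; last first.
- by apply: le_lt_trans aP; apply: harea_mono => x [].
- by have [q Qq] := half_interior_ex; exists q.
exists n.+1, (fun i => if unlift ord0 i is Some j then h j else (L, true)).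
rewrite /half_domain PE; apply/seteqP; split=> x.
  by move=> [Px Lx] i _; case: (unliftP ord0 i) => [j _|_]; [exact: Px|].
move=> hx; split; last by have := hx ord0 Logic.I; rewrite unlift_none.
by move=> j _; have := hx (lift ord0 j) Logic.I; rewrite liftK.
Qed.

(** The midpoint of two points of the side is not interior to [Q], so a form of [P] or that of [L]
    is at most 0 there and vanishes at both points. Hence [L'] carries a side of [P] or is [L]. *)
Lemma half_side_reflection L' f : side_of Q L' -> is_reflection L' f -> extended f.
Proof.
move=> sQ fL'; have [s sL'] := side_half_plane sQ.
have [_ [z [w [/eqP zw [Qz /gphi0 Lz] [Qw /gphi0 Lw]]]]] := sQ.
have [n [h [PE hs]]] := polygon_sides polyP.
have [m mE] := segment_mid z w.
have Lm : gphi L' m = 0.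
  have [k k0] := mE (- gB L') (- (2 * gA L')) (gC L').
  by rewrite -!/(gphi L' _) Lz Lw addr0 mulr0.
have /half_domainP[Pz Rz] := Qz; have /half_domainP[Pw Rw] := Qw.
have [i0|hm] := pselect (exists i, hfun (h i) m <= 0).
  have [i hi] := i0.
  have [k k0] := mE (sgn (h i).2 (- gB (h i).1)) (sgn (h i).2 (- (2 * gA (h i).1)))
    (sgn (h i).2 (gC (h i).1)).
  rewrite -!hfunE => e.
  have hz := (PE z).1 Pz i; have hw := (PE w).1 Pw i.
  have h0 : hfun (h i) z + hfun (h i) w <= 0 by rewrite -(pmulr_rle0 _ k0) -e.
  have /hfun0 z1 : hfun (h i) z = 0 by lra.
  have /hfun0 w1 : hfun (h i) w = 0 by lra.
  have [g gh] := reflection_ex (h i).1.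
  have [a Ga ga] := sideP (hs i) gh.
  right; exists a => //; rewrite -ga.
  exact: (reflection_eq zw Lz Lw z1 w1 fL' gh).
have [l|l] := leP (gphi L m) 0.
  have [k k0] := mE (- gB L) (- (2 * gA L)) (gC L); rewrite -!/(gphi L _) => e.
  have h0 : gphi L z + gphi L w <= 0 by rewrite -(pmulr_rle0 _ k0) -e.
  have z1 : gphi L z = 0 by lra.
  have w1 : gphi L w = 0 by lra.
  right; exists id => //; exact: (reflection_eq zw Lz Lw z1 w1 fL' rhoL).
have Qm : Q° m.
  have hn : \forall x \near m, forall i, i \in enum 'I_n -> 0 < hfun (h i) x.
    apply: near_seq => i _; apply: hfun_near; rewrite ltNge; apply/negP => le.
    by apply: hm; exists i.
  apply: filterS (filterI hn (lin_near l)) => x [xh xL]; apply/half_domainP; split; last exact: ltW.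
  by apply/PE => i; apply: ltW; apply: xh; rewrite mem_enum.
have := interior_hfun_gt0 Qm sL'.
by rewrite (_ : hfun (L', s) m = 0) ?ltxx //; exact/hfun0.
Qed.

(** Among the products of side reflections of [Q] with [g], one brings [q] nearest to itself; it
    takes [q] into [Q], so it is the identity. The base point is interior to [Q], since [z0] is
    fixed by [rho]. *)
Lemma extended_generated : extended = generated (reflections_in_sides Q).
Proof.
have sub : reflections_in_sides Q `<=` extended.
  by move=> f [L' sL' fL']; exact: half_side_reflection sL' fL'.
apply/seteqP; split; last exact: generated_sub extended_group sub.
move=> g Eg; have gW := generated_group extended_group sub.
have WE := generated_sub extended_group sub.
have [WI WM WV] := gW; have [_ EM _] := extended_group.
have [q Qq] := half_interior_ex.
pose B : set (H -> H) := [set t | exists2 k, generated (reflections_in_sides Q) k & t = k \o g].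
have Bg : B g by exists id.
have BE t : B t -> extended t by move=> [k /WE Ek ->]; exact: EM.
have [|t Bt tmin] := @exists_min R _ B (fun t => chd q (t q)) g Bg.
  apply: sub_finite_set (extended_orbit_finite q q (chd q (g q))).
  by move=> t [/BE Et le].
have [n [h [QE hs]]] := polygon_sides half_polygon.
have Qt : Q (t q).
  apply/QE => j; rewrite leNgt; apply/negP => lt.
  have [f fh] := reflection_ex (h j).1.
  have Bft : B (f \o t).
    have [k Wk ->] := Bt; exists (f \o k) => //; apply: WM => //.
    by apply: generated_in; exists (h j).1.
  have := tmin _ Bft; rewrite /= !(chdC q) (refl_chd_sub fh).
  have qj := interior_hfun_gt0 Qq (fun z Qz => (QE z).1 Qz j).
  move: lt qj; rewrite /hfun; case: (h j).2 => /= l1 l2; nra.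
have tid := half_free Qq (BE _ Bt) Qt.
have [k Wk tk] := Bt; have [k' Wk' [kk' k'k]] := WV _ Wk.
have -> : g = k'; last by [].
by apply: (cancel_uniq kk') => x; rewrite -[k (g x)]/((k \o g) x) -tk tid.
Qed.

Lemma extended_fundamental : fundamental_domain extended Q.
Proof.
split; first exact: half_polygon.
  apply/seteqP; split=> // x _; have [_ cov _] := fundP.
  have : (\bigcup_(g in Gamma) (g @` P)) x by rewrite cov.
  move=> [g Gg [p Pp <-]]; have [l|l] := leP 0 (gphi L p).
    by exists g; [left | exists p => //; apply/half_domainP].
  exists (g \o rho); first by right; exists g.
  exists (rho p); last by rewrite /= rhoK.
  apply/half_domainP; split; first exact: rho_mem.
  by rewrite (refl_phi rhoL) oppr_ge0 ltW.
move=> g Eg gn; apply/seteqP; split=> // x [Qx [y Qy yx]].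
by apply: gn; apply: (half_free Qy Eg); rewrite yx; exact: interior_subset.
Qed.

(** Evaluation at one point [q] interior to [Q] suffices: distinct elements have distinct values at
    [q], and only finitely many values lie near [f q]. The bound 9 is [chd_near] with
    [chd (f q) (f q)] equal to 1. *)
Lemma extended_discrete : discrete_isom_group extended.
Proof.
split; first exact: extended_group.
  move=> g Eg; have [_ _ /(_ _ Eg)[g' _ [h1 h2]]] := extended_group.
  split; first by exists g'.
  by move=> z w; rewrite !hdistE extended_chd.
move=> f Ef; have [q Qq] := half_interior_ex.
split; first exact: mem_set.
have /finite_seqP[s sE] := extended_orbit_finite (f q) q 9.
have Es g : g \in s -> extended g.
  by move=> gs; have [] : [set g | extended g /\ chd (f q) (g q) <= 9] g by rewrite sE.
have free g : extended g -> g q = f q -> g = f.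
  move=> Eg gf; have [_ EM /(_ _ Ef)[f' Ef' [ff' f'f]]] := extended_group.
  have : f' \o g = id.
    by apply: (half_free Qq (EM _ _ Ef' Eg)); rewrite /= gf ff'; exact: interior_subset.
  by move=> e; apply/funext => x; rewrite -[LHS]f'f -[f' (g x)]/((f' \o g) x) e.
have near_s : \forall y \near f q, forall g, g \in s -> g <> f -> 0 < bis (f q) (g q) y.
  apply: near_seq => g gs; have [->|gf] := pselect (g = f).
    by apply: filterE.
  suff : 0 < bis (f q) (g q) (f q) by move=> /lin_near; apply: filterS.
  rewrite bisE pmulr_rgt0 // subr_gt0 chdzz ltNge; apply/negP => /chd_le1 e.
  by apply: gf; apply: free => //; exact: Es.
pose A y := (forall g, g \in s -> g <> f -> 0 < bis (f q) (g q) y) /\ chd (f q) y <= 9.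
exists [set g : {ptws H -> H} | A (g q)].
  apply: (@proj_continuous H (fun=> H) q f A).
  apply: filterS (filterI near_s (chd_near (f q))) => y [ys yn]; split=> //.
  by have [_] := yn (f q); rewrite chdzz mulr1 chdC.
apply/seteqP; split=> g; last first.
  move=> ->; split=> //; split; last by rewrite chdzz ler1n.
  move=> g' g's g'f; rewrite bisE pmulr_rgt0 // subr_gt0 chdzz ltNge.
  by apply/negP => /chd_le1 e; apply: g'f; apply: free => //; exact: Es.
move=> [[gb g9] Eg]; apply: contrapT => gf.
have gs : g \in s by have : [set` s] g by rewrite -sE.
have := gb _ gs gf; rewrite bisE pmulr_rgt0 // subr_gt0 chdzz.
by rewrite ltNge chd_ge1.
Qed.

Lemma extended_index2 : index2_subgroup Gamma extended.
Proof.
split; [exact: groupG fuchsG | exact: extended_group | by left |].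
pose C1 := [set rho \o k | k in Gamma].
have CG g : Gamma g -> [set g \o k | k in Gamma] = Gamma.
  move=> Gg; apply/seteqP; split=> [_ [k Gk <-]|k Gk]; first exact: GM.
  have [g' Gg' [gg' g'g]] := GV Gg; exists (g' \o k); first exact: GM.
  by apply/funext => x; rewrite /= g'g.
have CR k : Gamma k -> [set (k \o rho) \o k' | k' in Gamma] = C1.
  move=> Gk; have Gk1 := conj_rho Gk; have [u Gu [_ uk]] := GV Gk1.
  apply/seteqP; split=> _ [k' Gk' <-].
    exists ((rho \o k \o rho) \o k'); first exact: GM.
    by apply/funext => x; rewrite /= rhoK.
  exists (u \o k'); first exact: GM.
  by apply/funext => x; apply: (can_inj rhoK); rewrite [RHS]rhoK -[RHS]uk.
have cosets : left_cosets Gamma extended = [set Gamma; C1].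
  apply/seteqP; split=> [_ [g [Gg|[k Gk ->]] <-]|X [->|->]].
  - by left; exact: CG.
  - by right; exact: CR.
  - by exists id; [left | exact: CG].
  - by exists rho; [right; exists id | rewrite -(CR id)].
(* In [Gamma], the map [rho] would be the identity since it fixes [z0]; but it moves the points off
   [L]. *)
have neq : Gamma <> C1.
  move=> e; have Gr : Gamma rho by rewrite e; exists id.
  have rid := cfree Gr rho0; have [q /half_interior[_ Lq]] := half_interior_ex.
  by have := refl_phi rhoL q; rewrite rid; lra.
rewrite cosets.
have -> : [set Gamma; C1] = [set` [fset Gamma; C1]%fset].
  apply/seteqP; split=> X /=; rewrite !inE.
    by move=> [] ->; rewrite eqxx ?orbT.
  by move=> /orP[] /eqP; tauto.
by apply/card_eq_fsetP; rewrite cardfs2; case: eqP.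
Qed.

Lemma dirichlet_reflection_group : exists Q G,
  [/\ polygon Q, discrete_reflection_group Q G & index2_subgroup Gamma G].
Proof.
exists half_domain, extended; split; [exact: half_polygon | | exact: extended_index2].
by split; [exact: extended_generated | exact: extended_discrete | exact: extended_fundamental].
Qed.

End ReflectionGroup.

(** * Double Dirichlet and DF domains *)

Section TwoCases.
Variable R : realType.
Local Notation H := (UHP R).
Implicit Types (z w m x : H) (f g : H -> H) (L : geodesic R) (Gamma : set (H -> H)) (P : set H).

Lemma moebius_fix2 (a b c d : R) f g L z w : a * d - b * c = -1 -> moebius a b c d f ->
  z <> w -> f z = z -> f w = w -> gphi L z = 0 -> gphi L w = 0 ->
  is_reflection L g -> f = g.
Proof.
move=> e hf zw fz fw Lz Lw gL.
have [da lz] := moebius_fix e hf fz; have [_ lw] := moebius_fix e hf fw.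
have n0 : (- b, - (2 * a), c) != (0, 0, 0).
  apply/eqP => -[e1 e2 e3]; move: e; rewrite e3.
  by rewrite (_ : a = 0); [rewrite mul0r mulr0; lra | lra].
have [k [eB eA eC]] := lin_prop zw Lz Lw lz lw n0.
have kA : gA L = k * a by lra.
have kB : gB L = k * b by lra.
rewrite da in e hf; apply: (moebius_reflection hf gL _ kA kB eC).
have := gE L; rewrite kA kB eC => <-.
by transitivity (- k ^+ 2 * (a * - a - b * c)); [rewrite e; ring | ring].
Qed.

(** The zero lower left entry says that infinity is fixed, so the axis is vertical, and
    [moebius_fix] makes it pass through [z]. *)
Lemma moebius_fix_infty (a b d : R) f g z : a * d - b * 0 = -1 -> moebius a b 0 d f ->
  f z = z -> is_reflection (Vertical (hRe z)) g -> f = g.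
Proof.
move=> e hf fz gL; have [da] := moebius_fix e hf fz.
rewrite lin_sign => /eqP; rewrite mulf_eq0 (gt_eqF (hU_gt0 z)) /= => /eqP bE.
rewrite da in e hf.
have a2 : a ^+ 2 = 1 by lra.
have b2 : b = - (2 * a * hRe z) by lra.
apply: (moebius_reflection (e := - a) hf gL) => /=; first by rewrite sqrrN.
- by rewrite mulNr -expr2 a2.
- by rewrite b2; ring: a2.
- by rewrite mulr0.
Qed.

Lemma double_dirichlet_case Gamma P : fuchsian Gamma -> double_dirichlet_domain Gamma P ->
  exists Q G, [/\ polygon Q, discrete_reflection_group Q G & index2_subgroup Gamma G].
Proof.
move=> fG [fP [z0 [z1 [z01 dP dP1]]]].
have [L [L0 L1]] := geodesic_ex z0 z1; have [rho rL] := reflection_ex L.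
apply: (dirichlet_reflection_group fG fP dP L0 rL) => L' f sL' fL'.
have [a [b [z [w [m [[Ga Gb ab ba] [zw Lz Lw] [an Pm Pbm] /(_ f fL') fz0 trans]]]]]] :=
  dirichlet_side fG fP dP sL'.
have zn : z1 <> a z1 by move=> /esym /(center_free fG fP dP1 Ga).
(* Both [m] and [b m] lie in the Dirichlet domain of [z1]; each gives one inequality. *)
have am : chd m (a z1) = chd m z1.
  apply/eqP; rewrite eq_le; apply/andP; split; last by apply: (dirichletP dP1 m).1.
  rewrite -[X in chd X _]ba (fuchsian_chd fG _ _ Ga) -[X in _ <= X](fuchsian_chd fG _ _ Gb).
  exact: (dirichletP dP1 (b m)).1.
have [bz bw] : bis z1 (a z1) z = 0 /\ bis z1 (a z1) w = 0.
  apply: trans => [x /(dirichletP dP1) /(_ _ Ga) ?|].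
    by rewrite -/(bis _ _ _) bisE mulr_ge0 // subr_ge0.
  by rewrite -/(bis _ _ _) bisE am subrr mulr0.
have fz1 := bis_reflection fL' zn zw Lz Lw bz bw.
exists a => //.
have [a' [b' [c' [d' [e hb]]]]] := fuchsian_moebius fG Gb.
have hT := moebius_comp hb (is_reflectionP fL').
have <- : b \o f = rho.
  apply: (moebius_fix2 _ hT z01) L0 L1 rL; rewrite /= ?fz0 ?fz1 ?ab //.
  transitivity (- (a' * d' - b' * c') * (gA L' ^+ 2 + gB L' * gC L')); first by ring.
  by rewrite e gE mulr1.
by apply/funext => x; rewrite /= ba.
Qed.

(** A group containing [tau], hence, by [generated_sub], all of the stabilizer of infinity. *)
Lemma translation_group (t : R) : transformation_group
  [set f | exists k : int, forall z, hRe (f z) = hRe z + k%:~R * t /\ hIm (f z) = hIm z].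
Proof.
split.
- by exists 0 => z; rewrite mul0r addr0.
- move=> f g [k hf] [l hg]; exists (k + l) => z /=.
  have [-> ->] := hf (g z); have [-> ->] := hg z.
  by rewrite rmorphD /=; split=> //; ring.
move=> f [k hf].
have /choice[g hg] : forall z, exists w, hRe w = hRe z - k%:~R * t /\ hIm w = hIm z.
  by move=> z; exact/UHP_ex/hIm_gt0.
exists g.
  by exists (- k) => z; have [-> ->] := hg z; rewrite rmorphN mulNr.
split=> z; apply: UHP_eq.
- by have [-> _] := hg (f z); have [-> _] := hf z; rewrite addrK.
- by have [_ ->] := hg (f z); have [_ ->] := hf z.
- by have [-> _] := hf (g z); have [-> _] := hg z; rewrite subrK.
- by have [_ ->] := hf (g z); have [_ ->] := hg z.
Qed.

(** By the identity hU(f z) = |cz + d|^2 hU(z), a Ford condition becomes the sign of the linear form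
    [hU (f z) - hU z]. *)
Lemma isometric_circleP (M : 'M[R]_2) f z : \det M = 1 -> acts_as M f ->
  outside_isometric_circle M z -> hU z <= hU (f z).
Proof.
move=> dM /(acts_as_moebius dM) /(_ z)[-> _ _]; rewrite /outside_isometric_circle /= => h.
have : 1 <= (M 1 0 * hRe z + M 1 1) ^+ 2 + (M 1 0 * hIm z) ^+ 2.
  have : 1 <= ComplexField.Normc.normc ((M 1 0)%:C * val z + (M 1 1)%:C) ^+ 2.
    by rewrite expr_ge1 // (le_trans _ h).
  rewrite normc_sqr /hRe /hIm; case: (val z) => x y /=.
  by rewrite !mul0r subr0 !addr0.
move=> k; have -> : M 1 0 ^+ 2 * hW z + 2 * M 1 0 * M 1 1 * hV z + M 1 1 ^+ 2 * hU z =
    hU z * ((M 1 0 * hRe z + M 1 1) ^+ 2 + (M 1 0 * hIm z) ^+ 2).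
  by rewrite /hW /hV /hU; field; exact: hIm_neq0.
by rewrite ler_peMr // ltW // hU_gt0.
Qed.

Lemma DF_case Gamma P : fuchsian Gamma -> DF_domain Gamma P ->
  exists Q G, [/\ polygon Q, discrete_reflection_group Q G & index2_subgroup Gamma G].
Proof.
move=> fG [fP [_ [x0 [t [tau [t0 htau stabE PE]]]]] [z0 dP]].
have [rho rL] := reflection_ex (Vertical (hRe z0)).
have L0 : gphi (Vertical (hRe z0)) z0 = 0 by apply/gphi0; rewrite /geodesic_line /= subrr.
have tgT := @translation_group t.
have tauT : [set tau] `<=` [set f | exists k : int, forall z,
    hRe (f z) = hRe z + k%:~R * t /\ hIm (f z) = hIm z].
  move=> _ ->; exists 1 => z; rewrite mul1r /hRe /hIm htau.
  by case: (val z) => x y /=; rewrite addr0.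
have stabT g : stab_infty Gamma g -> exists k : int, forall z,
    hRe (g z) = hRe z + k%:~R * t /\ hIm (g z) = hIm z.
  by rewrite stabE => /(generated_sub tgT tauT).
have stab_group : transformation_group (stab_infty Gamma).
  by rewrite stabE; exact: generated_group tgT tauT.
have strip x : P x -> x0 <= hRe x <= x0 + t by rewrite PE => -[].
have outside g x : Gamma g -> ~ stab_infty Gamma g -> P x -> hU x <= hU (g x).
  move=> Gg ng; rewrite PE => -[_ h].
  have [_ /(_ _ Gg)[M dM hM] _] := fG.
  by apply: (isometric_circleP dM hM); apply: h hM.
apply: (dirichlet_reflection_group fG fP dP L0 rL) => L' f sL' fL'.
have [a [b [z [w [m [[Ga Gb ab ba] [zw Lz Lw] [an Pm Pbm] /(_ f fL') fz0 trans]]]]]] :=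
  dirichlet_side fG fP dP sL'.
exists a => //.
have [_ /(_ _ Gb)[M dM hM] _] := fG; have hb := acts_as_moebius dM hM.
have hT := moebius_comp hb (is_reflectionP fL').
(* The lower left entry of the matrix of [b \o f]: its vanishing says that this map fixes
   infinity. *)
suff c0 : M 1 0 * gA L' + M 1 1 * gC L' = 0.
  have <- : b \o f = rho.
    rewrite c0 in hT; apply: (moebius_fix_infty _ hT) rL; last by rewrite /= fz0 ab.
    rewrite -c0.
    transitivity (- (M 0 0 * M 1 1 - M 0 1 * M 1 0) * (gA L' ^+ 2 + gB L' * gC L')); first by ring.
    by rewrite -det_mx2 dM gE mulr1.
  by apply/funext => x; rewrite /= ba.
have bn : b <> id by move=> bE; apply: an; apply/funext => x; rewrite -[RHS]ba bE.
(* If [b] is a nontrivial translation, then [m] and [b m] both lie in a strip of width [t], so [m]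
   is on an edge of the strip and [L'] is that vertical edge. *)
have [sb|nsb] := pselect (stab_infty Gamma b).
  have [k hk] := stabT _ sb.
  have k0 : k != 0.
    apply/eqP => k0; apply: bn; apply/funext => x.
    by have [e1 e2] := hk x; apply: UHP_eq; rewrite // e1 k0 mul0r addr0.
  (* A translation preserves heights; comparing them at i and 2i gives two equations in the squares
     of [M 1 0] and [M 1 1]. *)
  have M10 : M 1 0 = 0.
    have [e1 _ _] := hb z0.
    have eU z' : hU z' = M 1 0 ^+ 2 * hW z' + 2 * M 1 0 * M 1 1 * hV z' + M 1 1 ^+ 2 * hU z'.
      by have [<- _ _] := hb z'; rewrite /hU; have [_ ->] := hk z'.
    have [i [ix iy]] := @UHP_ex R 0 1 ltr01.
    have [j [jx jy]] := @UHP_ex R 0 2 (ltr0n _ 2).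
    have := eU j; have := eU i; rewrite /hU /hV /hW ix iy jx jy => h1 h2.
    by apply/eqP; rewrite -sqrf_eq0; apply/eqP; lra.
  rewrite M10 mul0r add0r; suff -> : gC L' = 0 by rewrite mulr0.
  have [s1 s2] := andP (strip _ Pm); have := strip _ Pbm; have [-> _] := hk m => /andP[s3 s4].
  have [kp|kn] : (1 <= k%:~R :> R) \/ (1 <= (- k)%:~R :> R).
    by move: k0; rewrite neq_lt => /orP[k0|k0]; [right|left];
      rewrite (ler_int R 1) -gtz0_ge1 ?oppr_gt0.
  - have kt : t <= k%:~R * t by rewrite ler_peMl // ltW.
    have [h1 h2] : lin (- x0) 1 0 z = 0 /\ lin (- x0) 1 0 w = 0.
      apply: trans => [x /strip /andP[? ?]|]; rewrite lin_sign.
        by rewrite pmulr_rge0 ?hU_gt0 //; lra.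
      by rewrite (_ : hRe m = x0); [ring | lra].
    have n0 : (- x0, 1, 0) != (0, 0, 0) :> R * R * R.
      by apply/eqP => -[_ /eqP]; rewrite oner_eq0.
    by have [l [_ _ ->]] := lin_prop zw Lz Lw h1 h2 n0; rewrite mulr0.
  - have kt : t <= - (k%:~R * t) by rewrite -mulNr -rmorphN ler_peMl // ltW.
    have [h1 h2] : lin (x0 + t) (- 1) 0 z = 0 /\ lin (x0 + t) (- 1) 0 w = 0.
      apply: trans => [x /strip /andP[? ?]|]; rewrite lin_sign.
        by rewrite pmulr_rge0 ?hU_gt0 //; lra.
      by rewrite (_ : hRe m = x0 + t); [ring | lra].
    have n0 : (x0 + t, - 1, 0) != (0, 0, 0) :> R * R * R.
      by apply/eqP => -[_ /eqP]; rewrite oppr_eq0 oner_eq0.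
    by have [l [_ _ ->]] := lin_prop zw Lz Lw h1 h2 n0; rewrite mulr0.
have nsa : ~ stab_infty Gamma a.
  move=> sa; apply: nsb; have [_ _ /(_ _ sa)[a' sa' [aa' a'a]]] := stab_group.
  by rewrite (cancel_uniq aa' ba).
(* The form of the isometric circle of [b] is nonnegative on [P]. It vanishes at [m] by the Ford
   conditions of [b] at [m] and of [a] at [b m], so [L'] is that circle. *)
have chiE x : lin (M 1 1 ^+ 2 - 1) (2 * M 1 0 * M 1 1) (M 1 0 ^+ 2) x = hU (b x) - hU x.
  by have [-> _ _] := hb x; rewrite /lin; ring.
have [h1 h2] : lin (M 1 1 ^+ 2 - 1) (2 * M 1 0 * M 1 1) (M 1 0 ^+ 2) z = 0 /\
    lin (M 1 1 ^+ 2 - 1) (2 * M 1 0 * M 1 1) (M 1 0 ^+ 2) w = 0.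
  apply: trans => [x Px|]; rewrite chiE; first by rewrite subr_ge0; exact: outside.
  have := outside _ _ Ga nsa Pbm; have := outside _ _ Gb nsb Pm; rewrite ba; lra.
have c0 : M 1 0 != 0.
  by apply/eqP => c0; apply: nsb; split=> //; exists M.
have n0 : (M 1 1 ^+ 2 - 1, 2 * M 1 0 * M 1 1, M 1 0 ^+ 2) != (0, 0, 0).
  by apply/eqP => -[_ _ /eqP]; rewrite sqrf_eq0 (negbTE c0).
have [k [_ eA ->]] := lin_prop zw Lz Lw h1 h2 n0.
have -> : gA L' = - (k * M 1 0 * M 1 1) by lra.
by ring.
Qed.

End TwoCases.

Theorem theorem5p3 (R : realType) (Gamma : set (UHP R -> UHP R)) :
  fuchsian Gamma -> finitely_generated Gamma -> finite_coarea Gamma ->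
  (exists P : set (UHP R),
     double_dirichlet_domain Gamma P \/ DF_domain Gamma P) ->
  exists (Q : set (UHP R)) (G : set (UHP R -> UHP R)),
    [/\ polygon Q, discrete_reflection_group Q G & index2_subgroup Gamma G].
Proof.
move=> fG _ _ [P [dd|df]]; first exact: double_dirichlet_case fG dd.
exact: DF_case fG df.
Qed.
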